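(* Let $\Omega$ be a solvable sesquilinear form on $\mathcal{D}$ with respect to an inner product and with associated operator $T$. Let $$\Omega(\xi,\eta)=\langle QH\xi,H\eta\rangle,\qquad\forall\,\xi,\eta\in\mathcal{D},$$ be a Radon-Nikodym-like representation of $\Omega$. Suppose, moreover, that $\Upsilon\in\mathfrak{P}(\Omega)$, that $B\in\mathcal{B}(\mathcal{H})$ is the operator associated to $\Upsilon$ (that is, $\Upsilon(\xi,\eta)=\langle B\xi,\eta\rangle$ for all $\xi,\eta\in\mathcal{H}$), and that $T+B=U_B|T+B|$ is the polar decomposition of $T+B$. The following statements are equivalent. 1. $\Omega$ is hyper-solvable, i.e. $D(|T|^{1/2})=\mathcal{D}$; 2. the operators $X=H^{-1}|T+B|H^{-1}$ and $Y=H|T+B|^{-1}H$, defined on $D(X)=HD(T)$ and $\mathcal{D}$, respectively, are bounded; 3. the operators $K_1=HU_BH^{-1}$ and $K_2=HU_B^*H^{-1}$ are bounded on $\mathcal{H}$; 4. $U_B\mathcal{D}=\mathcal{D}$.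
   Context: $\mathcal{H}$ is a complex Hilbert space with inner product $\langle\cdot,\cdot\rangle$ (linear in the first variable) and norm $\|\cdot\|$; $\mathcal{D}$ is a dense subspace of $\mathcal{H}$; sesquilinear forms are linear in the first and conjugate-linear in the second variable. $\mathcal{B}(\mathcal{H})$ is the set of bounded everywhere defined operators on $\mathcal{H}$ and $\rho(A)$ denotes the resolvent set of $A$. A sesquilinear form $\Omega$ on $\mathcal{D}$ is q-closed with respect to a norm $\|\cdot\|_\Omega$ on $\mathcal{D}$ if: (i) there is $\alpha>0$ with $\|\xi\|\le\alpha\|\xi\|_\Omega$ for all $\xi\in\mathcal{D}$; (ii) $\mathcal{E}_\Omega:=(\mathcal{D},\|\cdot\|_\Omega)$ is a reflexive Banach space; (iii) there is $\beta>0$ with $|\Omega(\xi,\eta)|\le\beta\|\xi\|_\Omega\|\eta\|_\Omega$ for all $\xi,\eta\in\mathcal{D}$. Let $\mathcal{E}_\Omega^\times$ be the space of bounded conjugate linear functionals on $\mathcal{E}_\Omega$. $\mathfrak{P}(\Omega)$ is the set of bounded sesquilinear forms $\Upsilon$ on $\mathcal{H}$ such that: (1) if $\xi\in\mathcal{D}$ and $(\Omega+\Upsilon)(\xi,\eta)=0$ for all $\eta\in\mathcal{D}$ then $\xi=0$; (2) for every $\Lambda\in\mathcal{E}_\Omega^\times$ there is $\xi\in\mathcal{D}$ with $\Lambda(\eta)=(\Omega+\Upsilon)(\xi,\eta)$ for all $\eta\in\mathcal{D}$. $\Omega$ is solvable (with respect to $\|\cdot\|_\Omega$) if it is q-closed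 and $\mathfrak{P}(\Omega)\neq\emptyset$; it is q-closed (solvable) with respect to an inner product if $\|\cdot\|_\Omega$ is a Hilbert norm. All norms with respect to which $\Omega$ is q-closed are known to be equivalent. The operator $T$ associated to a solvable form $\Omega$ is given by: $\xi\in D(T)$ and $T\xi=\chi$ if and only if $\xi\in\mathcal{D}$, $\chi\in\mathcal{H}$ and $\Omega(\xi,\eta)=\langle\chi,\eta\rangle$ for all $\eta\in\mathcal{D}$. It is known that $T$ is closed and densely defined, and $0\in\rho(T+B)$. For a closed densely defined operator $A$, $|A|=(A^*A)^{1/2}$. A Radon-Nikodym-like representation of $\Omega$ is an expression $\Omega(\xi,\eta)=\langle QH\xi,H\eta\rangle$ for all $\xi,\eta\in\mathcal{D}$, where $Q\in\mathcal{B}(\mathcal{H})$ and $H$ is a positive self-adjoint operator with $D(H)=\mathcal{D}$ and $0\in\rho(H)$. The operators $K_1,K_2$ are considered on their natural domains $\{\xi\in\mathcal{H}:U_BH^{-1}\xi\in\mathcal{D}\}$ and $\{\xi\in\mathcal{H}:U_B^*H^{-1}\xi\in\mathcal{D}\}$; ''bounded on $\mathcal{H}$'' means everywhere defined and bounded. $X$ and $Y$ being bounded means bounded in the norm of $\mathcal{H}$ on the indicated domains. *)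

(* Defs.v *)
From HB Require Import structures.
From mathcomp Require Import all_boot all_order all_algebra.
From mathcomp Require Import complex.
From mathcomp Require Import all_classical all_reals all_analysis.

Set Implicit Arguments.
Unset Strict Implicit.
Unset Printing Implicit Defensive.

Import Order.TTheory GRing.Theory Num.Theory.
Import numFieldNormedType.Exports.

Local Open Scope classical_set_scope.
Local Open Scope ring_scope.

(* The norm of a module over R[i] takes its values in R[i], and x <= y in R[i]
   means that y - x is a nonnegative real. The form inner is linear in its first
   argument and conjugate linear in the second. *)
HB.mixin Record CompleteNormedModule_isHilbert (R : realType) V
    of CompleteNormedModule R[i] V := {
  inner : {dot V for (@Num.conj R[i])} ;
  inner_normE : forall x : V, `|x| ^+ 2 = inner x x
}.

#[short(type="hilbertType")]
HB.structure Definition Hilbert (R : realType) :=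
  {V of CompleteNormedModule R[i] V & CompleteNormedModule_isHilbert R V}.

Notation "''[' x , y ]" := (inner x y)
  (at level 0, format "''[' x ,  y ]") : ring_scope.

(* Possibly unbounded operators, encoded by their graphs: A (x, y) means that
   x is in the domain of A and A x = y. *)
Section Operators.
Context {R : realType} {V : hilbertType R}.
Local Notation C := R[i].

Definition operator := set (V * V).
Implicit Types (A B : operator) (S : set V).

Definition linear_subspace S :=
  S 0 /\ forall (a : C) x y, S x -> S y -> S (a *: x + y).

Definition linear_operator A :=
  [/\ A (0, 0),
      forall (a : C) x x' y y', A (x, x') -> A (y, y') ->
        A (a *: x + y, a *: x' + y')
    & forall y, A (0, y) -> y = 0].

Definition dom A : set V := [set x | exists y, A (x, y)].
Definition ran A : set V := [set y | exists x, A (x, y)].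
Definition ker A : set V := [set x | A (x, 0)].
Definition op_image A S : set V := [set y | exists2 x, S x & A (x, y)].

Definition graph (f : V -> V) : operator := [set p | p.2 = f p.1].

Definition op_add A B : operator :=
  [set p | exists a b, [/\ A (p.1, a), B (p.1, b) & p.2 = a + b]].
Definition op_comp A B : operator :=
  [set p | exists2 y, B (p.1, y) & A (y, p.2)].
Definition op_inv A : operator := (A ^-1)%relation.

Definition adjoint A : operator :=
  [set p | forall x y, A (x, y) -> '[y, p.1] = '[x, p.2]].

Definition op_bounded A :=
  exists c : C, forall x y, A (x, y) -> `|y| <= c * `|x|.

Definition bounded_everywhere A :=
  [/\ linear_operator A, dom A = setT & op_bounded A].

Definition resolvent_set A : set C :=
  [set l | bounded_everywhere (op_inv (op_add A (graph (fun x => - l *: x))))].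

Definition self_adjoint A :=
  [/\ linear_operator A, dense (dom A) & A = adjoint A].

Definition op_positive A := forall x y, A (x, y) -> 0 <= '[y, x].

(* A^(1/2) for a positive self-adjoint A; set0 if A has no such root *)
Definition op_sqrt A : operator :=
  xget set0 [set S : operator |
    [/\ self_adjoint S, op_positive S & op_comp S S = A]].

(* |A| = (A^* A)^(1/2) *)
Definition op_abs A : operator := op_sqrt (op_comp (adjoint A) A).

Definition partial_isometry (U : {linear V -> V}) :=
  op_bounded (graph U) /\
  forall x, (forall y, U y = 0 -> '[x, y] = 0) -> `|U x| = `|x|.

(* A = U |A|, with U a partial isometry of initial space (ker A)^\perp and
   final space the closure of the range of A *)
Definition polar_decomposition A (U : {linear V -> V}) :=
  [/\ partial_isometry U,
      ker (graph U) = ker A,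
      ran (graph U) = closure (ran A)
    & A = op_comp (graph U) (op_abs A)].

End Operators.

Arguments operator {R} V.

(* Forms and norms on a subspace D are functions on the whole of V of which
   only the restriction to D matters. *)
Section Forms.
Context {R : realType} {V : hilbertType R}.
Local Notation C := R[i].
Implicit Types (D : set V) (N : V -> C) (Om Up : V -> V -> C).

Definition linear_on D (f : V -> C) :=
  forall (a : C) x y, D x -> D y -> f (a *: x + y) = a * f x + f y.

Definition conj_linear_on D (f : V -> C) :=
  forall (a : C) x y, D x -> D y -> f (a *: x + y) = a^* * f x + f y.

Definition sesquilinear_on D Om :=
  (forall y, D y -> linear_on D (Om ^~ y)) /\
  (forall x, D x -> conj_linear_on D (Om x)).

Definition functional_bounded_on D N (f : V -> C) :=
  exists c : C, forall x, D x -> `|f x| <= c * N x.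

Definition norm_on D N :=
  [/\ forall x, D x -> 0 <= N x,
      forall x, D x -> N x = 0 -> x = 0,
      forall (a : C) x, D x -> N (a *: x) = `|a| * N x
    & forall x y, D x -> D y -> N (x + y) <= N x + N y].

Definition inner_product_on D (ip : V -> V -> C) :=
  [/\ sesquilinear_on D ip,
      forall x y, D x -> D y -> ip y x = (ip x y)^*
    & forall x, D x -> x != 0 -> 0 < ip x x].

Definition hilbert_norm_on D N :=
  exists2 ip : V -> V -> C, inner_product_on D ip
    & forall x, D x -> N x ^+ 2 = ip x x.

Definition complete_on D N :=
  forall u : nat -> V, (forall n, D (u n)) ->
    (forall e : C, 0 < e -> exists n0 : nat, forall m n,
       (n0 <= m)%N -> (n0 <= n)%N -> N (u m - u n) < e) ->
    exists2 x, D x &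
      forall e : C, 0 < e -> exists n0 : nat, forall n,
        (n0 <= n)%N -> N (u n - x) < e.

Definition dual D N : set (V -> C) :=
  [set f | linear_on D f /\ functional_bounded_on D N f].

(* The bounded linear functionals on the dual; the operator norm of f enters
   through its upper bounds k. *)
Definition bidual D N : set ((V -> C) -> C) :=
  [set F | (forall (a : C) f g, dual D N f -> dual D N g ->
              F (fun x => a * f x + g x) = a * F f + F g) /\
           exists c : C, forall f (k : C), dual D N f -> 0 <= k ->
              (forall x, D x -> `|f x| <= k * N x) -> `|F f| <= c * k].

Definition reflexive_on D N :=
  forall F, bidual D N F ->
    exists2 x, D x & forall f, dual D N f -> F f = f x.

Definition q_closed D Om N :=
  [/\ norm_on D N,
      exists2 alpha : C, 0 < alpha & forall x, D x -> `|x| <= alpha * N x,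
      complete_on D N,
      reflexive_on D N
    & exists2 beta : C, 0 < beta &
        forall x y, D x -> D y -> `|Om x y| <= beta * N x * N y].

Definition bounded_form Up :=
  sesquilinear_on setT Up /\
  exists c : C, forall x y, `|Up x y| <= c * `|x| * `|y|.

Definition conj_dual D N : set (V -> C) :=
  [set L | conj_linear_on D L /\ functional_bounded_on D N L].

(* the set P(Om) of admissible perturbations *)
Definition perturbations D Om N : set (V -> V -> C) :=
  [set Up |
    [/\ bounded_form Up,
        forall x, D x -> (forall y, D y -> Om x y + Up x y = 0) -> x = 0
      & forall L, conj_dual D N L ->
          exists2 x, D x & forall y, D y -> L y = Om x y + Up x y]].

Definition solvable_form D Om N :=
  q_closed D Om N /\ perturbations D Om N !=set0.

Definition associated_operator D Om : operator V :=
  [set p | D p.1 /\ forall y, D y -> Om p.1 y = '[p.2, y]].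

Definition hyper_solvable D Om :=
  dom (op_sqrt (op_abs (associated_operator D Om))) = D.

Definition radon_nikodym_representation D Om (Q : {linear V -> V})
    (H : operator V) :=
  [/\ op_bounded (graph Q),
      self_adjoint H /\ op_positive H,
      dom H = D,
      resolvent_set H 0
    & forall x y x' y', H (x, x') -> H (y, y') -> Om x y = '[Q x', y']].

End Forms.

(* Main.v *)
Require Import Defs.
From HB Require Import structures.
From mathcomp Require Import all_boot all_order all_algebra.
From mathcomp Require Import complex.
From mathcomp Require Import all_classical all_reals all_analysis.
From mathcomp Require Import ring lra.
Set Implicit Arguments.
Unset Strict Implicit.
Unset Printing Implicit Defensive.
Import Order.TTheory GRing.Theory Num.Theory.
Import numFieldNormedType.Exports.
Local Open Scope classical_set_scope.
Local Open Scope ring_scope.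

(* Write G = H^-1, A = T + B = U P with P = |A|, and Q' = Q + G B G. The form
   Om + Up is <Q' H x, H y>, which gives Q' H P^-1 = G U; since Up is
   admissible, Q' is boundedly invertible, so |H P^-1 z| and |G U z| are
   equivalent norms of z.
   - (4) says that U and U^-1 preserve ran G, i.e. (Douglas, uniform
     boundedness) that |G U z| and |G z| are equivalent.
   - (3) is equivalent to (4) by the Hellinger-Toeplitz theorem.
   - (2) says that |H P^-1 z| and |G z| are equivalent, because X maps H P^-1 z
     to G z and Y maps G z to H P^-1 z.
   - Cauchy-Schwarz for the form of P^-1 turns this into the equivalence of
     <P^-1 z, z> and |G z|^2. As dom |T| = dom P, Reid's inequality makes
     <P^-1 z, z> equivalent to <(1 + |T|)^-1 z, z>, and a vector x lies in
     dom |T|^(1/2) iff <z, x>^2 <= c <(1 + |T|)^-1 z, z> for some c; hence (1).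
   All estimates use the real inner product Re <x, y> and real scalars, which
   determine adjoints of complex linear operators. *)

(** * Real semi-inner products *)

Section RealForms.
Context {R : realType} {E : lmodType R[i]}.
Implicit Types (f : E -> R) (ip : E -> E -> R).

(** The criteria for a vector to lie in [dom |T|^(1/2)] or in [ran G] are duality statements whose
    constant depends on the vector. An equality of two such sets is turned by uniform boundedness,
    on [V] or on the graph of the root, into a domination uniform in [z]; conversely, a domination
    transports the criterion from one set to the other. This takes the place of spectral calculus.

    Only [T + B] is known to be injective, whereas [T] may have a kernel: hence [P] is inverted
    directly, while [|T|] enters through [(1 + |T|)^-1]. These two inverses are compared through
    their ranges, both equal to [dom T] because [B] is everywhere defined.

    A square root is known only through self-adjointness, positivity and its square. All facts about
    [op_sqrt] are derived from these, so that they hold for whichever root is selected. *)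

Definition real_linear f :=
  forall (a : R) x y, f (a%:C%C *: x + y) = a * f x + f y.

Lemma real_linearD f : real_linear f -> forall x y, f (x + y) = f x + f y.
Proof. by move=> lf x y; rewrite -[x in LHS]scale1r (lf 1) mul1r. Qed.

Lemma real_linear0 f : real_linear f -> f 0 = 0.
Proof. by move=> lf; have := real_linearD lf 0 0; rewrite addr0; lra. Qed.

Lemma real_linearZ f : real_linear f -> forall a x, f (a%:C%C *: x) = a * f x.
Proof.
by move=> lf a x; rewrite -[_ *: x]addr0 lf (real_linear0 lf) addr0.
Qed.

Lemma real_linearN f : real_linear f -> forall x, f (- x) = - f x.
Proof.
by move=> lf x; have := real_linearD lf x (- x); rewrite subrr real_linear0 //; lra.
Qed.

Lemma real_linearB f : real_linear f -> forall x y, f (x - y) = f x - f y.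
Proof. by move=> lf x y; rewrite (real_linearD lf) (real_linearN lf). Qed.

(** Degenerate forms are allowed: instances below, such as [rdot p.2 q.2] on [V * V], vanish on
    nonzero vectors. *)
Definition semi_inner ip :=
  [/\ forall z, real_linear (ip ^~ z), forall x y, ip x y = ip y x
    & forall x, 0 <= ip x x].

Section Form.
Variable (ip : E -> E -> R) (ipP : semi_inner ip).

Let lin z : real_linear (ip ^~ z). Proof. by case: ipP. Qed.

Lemma siC x y : ip x y = ip y x. Proof. by case: ipP. Qed.
Lemma si_ge0 x : 0 <= ip x x. Proof. by case: ipP. Qed.
Lemma siDl x y z : ip (x + y) z = ip x z + ip y z.
Proof. exact: real_linearD (lin z) x y. Qed.
Lemma siZl a x z : ip (a%:C%C *: x) z = a * ip x z.
Proof. exact: real_linearZ (lin z) a x. Qed.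
Lemma siNl x z : ip (- x) z = - ip x z.
Proof. exact: real_linearN (lin z) x. Qed.
Lemma siBl x y z : ip (x - y) z = ip x z - ip y z.
Proof. exact: real_linearB (lin z) x y. Qed.
Lemma siDr x y z : ip z (x + y) = ip z x + ip z y.
Proof. by rewrite !(siC z) siDl. Qed.
Lemma siZr a x z : ip z (a%:C%C *: x) = a * ip z x.
Proof. by rewrite !(siC z) siZl. Qed.
Lemma siNr x z : ip z (- x) = - ip z x.
Proof. by rewrite !(siC z) siNl. Qed.
Lemma siBr x y z : ip z (x - y) = ip z x - ip z y.
Proof. by rewrite !(siC z) siBl. Qed.

Definition siE := (siDl, siDr, siBl, siBr, siNl, siNr, siZl, siZr).

Lemma si_cauchy_schwarz x y : ip x y ^+ 2 <= ip x x * ip y y.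
Proof.
have q t : 0 <= ip x x + 2 * t * ip x y + t ^+ 2 * ip y y.
  have := si_ge0 (x + t%:C%C *: y); rewrite !siE (siC y x); lra.
have xx := si_ge0 x; have yy := si_ge0 y.
have [y0|yn0] := eqVneq (ip y y) 0; last first.
  have yp : 0 < ip y y by rewrite lt_def yn0.
  have := q (- ip x y / ip y y).
  have -> : ip x x + 2 * (- ip x y / ip y y) * ip x y +
     (- ip x y / ip y y) ^+ 2 * ip y y = (ip x x * ip y y - ip x y ^+ 2) / ip y y.
    by field.
  by rewrite pmulr_lge0 ?invr_gt0// subr_ge0.
rewrite y0 mulr0; have [->|xy0] := eqVneq (ip x y) 0; first by rewrite expr0n.
(* When [ip y y = 0] the polynomial is affine in [t]; this [t] gives it the value -1. *)
have := q (- (ip x x + 1) / (2 * ip x y)); rewrite y0 mulr0 addr0.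
have -> : 2 * (- (ip x x + 1) / (2 * ip x y)) * ip x y = - (ip x x + 1) by field.
lra.
Qed.

Lemma si_cauchy_schwarz_sqrt x y :
  `|ip x y| <= Num.sqrt (ip x x) * Num.sqrt (ip y y).
Proof.
rewrite -sqrtrM ?si_ge0// -sqrtr_sqr ler_sqrt ?si_cauchy_schwarz//.
by rewrite mulr_ge0 ?si_ge0.
Qed.

Lemma si_triangle x y :
  Num.sqrt (ip (x + y) (x + y)) <= Num.sqrt (ip x x) + Num.sqrt (ip y y).
Proof.
have h := le_trans (ler_norm _) (si_cauchy_schwarz_sqrt x y).
rewrite -(@ler_pXn2r _ 2)// ?nnegrE ?addr_ge0 ?sqrtr_ge0//.
rewrite sqrrD !sqr_sqrtr ?si_ge0// !siE (siC y x); lra.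
Qed.

Lemma si_sqrtZ a x :
  Num.sqrt (ip (a%:C%C *: x) (a%:C%C *: x)) = `|a| * Num.sqrt (ip x x).
Proof. by rewrite !siE mulrA -expr2 sqrtrM ?sqr_ge0// sqrtr_sqr. Qed.

End Form.

End RealForms.

Section Sequences.
Context {R : realType} {E : zmodType}.

(** Convergence refers to a bare function [N], so that one notion serves the norm of [V], the norm
    of the form, graph norms and seminorms. *)
Definition cauchy_for (N : E -> R) (u : nat -> E) :=
  forall e : R, 0 < e -> exists n0, forall m n,
    (n0 <= m)%N -> (n0 <= n)%N -> N (u m - u n) < e.

Definition tends_for (N : E -> R) (u : nat -> E) (x : E) :=
  forall e : R, 0 < e -> exists n0, forall n, (n0 <= n)%N -> N (u n - x) < e.

End Sequences.

(** * The real inner product underlying a complex Hilbert space *)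

Section RealDot.
Context {R : realType} {V : hilbertType R}.
Implicit Types (x y z : V) (S : set V).

Definition rdot x y : R := complex.Re '[x, y].
Definition nrm x : R := Num.sqrt (rdot x x).

Lemma inner_conj x y : '[x, y] = ('[y, x])^*.
Proof. by rewrite hermC expr0 mul1r. Qed.

Lemma rdot_semi_inner : semi_inner rdot.
Proof.
split.
- move=> z a x y; rewrite /rdot linearDl linearZl_LR/=.
  by case: (inner x z) (inner y z) => [p q] [r s]/=; rewrite mul0r subr0.
- by move=> x y; rewrite /rdot (inner_conj x y); case: '[y, x].
- move=> x; have : 0 <= '[x, x] by rewrite -inner_normE exprn_ge0.
  by rewrite lecE => /andP[].
Qed.

Definition rdotC := siC rdot_semi_inner.
Definition rdotE := siE rdot_semi_inner.
Definition rdot_ge0 := si_ge0 rdot_semi_inner.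

Lemma rdot_nrm x : rdot x x = nrm x ^+ 2.
Proof. by rewrite sqr_sqrtr// rdot_ge0. Qed.

Lemma nrm_ge0 x : 0 <= nrm x. Proof. exact: sqrtr_ge0. Qed.

Lemma normE x : `|x| = (nrm x)%:C%C.
Proof.
have xr : (complex.Re `|x|)%:C%C = `|x| by rewrite RRe_real// normr_real.
have x0 : 0 <= complex.Re `|x|.
  by have : 0 <= `|x| by []; rewrite lecE => /andP[].
rewrite -xr; congr (_%:C%C); apply/esym/eqP.
rewrite -(@eqrXn2 _ 2)// ?nrm_ge0// -rdot_nrm /rdot -inner_normE -xr.
by rewrite -rmorphXn.
Qed.

Lemma nrm_eq0 x : nrm x = 0 -> x = 0.
Proof. by move=> x0; apply/eqP; rewrite -normr_eq0 normE x0. Qed.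

Lemma rdot_eq0 x : rdot x x = 0 -> x = 0.
Proof. by move=> x0; apply: nrm_eq0; rewrite /nrm x0 sqrtr0. Qed.

Lemma rdotx0 x : rdot x 0 = 0.
Proof. by rewrite -(scale0r x) -[0]/(0%:C%C) (siZr rdot_semi_inner) mul0r. Qed.
Lemma rdot0x x : rdot 0 x = 0.
Proof. by rewrite rdotC rdotx0. Qed.

Lemma nrm0 : nrm 0 = 0.
Proof. by rewrite /nrm rdotx0 sqrtr0. Qed.

Lemma nrmN x : nrm (- x) = nrm x.
Proof. by rewrite /nrm !rdotE opprK. Qed.

Lemma nrmB x y : nrm (x - y) = nrm (y - x).
Proof. by rewrite -nrmN opprB. Qed.

Lemma nrmD x y : nrm (x + y) <= nrm x + nrm y.
Proof. exact: (si_triangle rdot_semi_inner). Qed.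

Lemma nrmZ a x : nrm (a%:C%C *: x) = `|a| * nrm x.
Proof. exact: (si_sqrtZ rdot_semi_inner). Qed.

Lemma nrm_dot x y : `|rdot x y| <= nrm x * nrm y.
Proof. exact: (si_cauchy_schwarz_sqrt rdot_semi_inner). Qed.

Lemma rdot_le x y : rdot x y <= nrm x * nrm y.
Proof. exact: le_trans (ler_norm _) (nrm_dot _ _). Qed.

Lemma rdot_orth_eq x y : (forall z, rdot z x = rdot z y) -> x = y.
Proof.
move=> h; apply/eqP; rewrite -subr_eq0; apply/eqP/rdot_eq0.
by rewrite (siBr rdot_semi_inner) h subrr.
Qed.

Lemma Im_inner x y : complex.Im '[x, y] = - rdot ('i%C *: x) y.
Proof. by rewrite /rdot linearZl_LR/=; case: (inner x y) => [a b] /=; ring. Qed.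

(** The imaginary part of an inner product is, up to sign, a real inner product with [i x]. Real
    identities that persist under multiplication by [i] thus become complex ones. *)
Lemma inner_rdot_eq x y z w : rdot x y = rdot z w ->
  rdot ('i%C *: x) y = rdot ('i%C *: z) w -> '[x, y] = '[z, w].
Proof.
move=> h1 h2; apply/eqP; rewrite eq_complex; apply/andP; split; apply/eqP => //.
by rewrite !Im_inner h2.
Qed.

Lemma hilbert_complete (u : nat -> V) :
  cauchy_for nrm u -> exists x, tends_for nrm u x.
Proof.
move=> cu.
have : cvg (u @ \oo).
  apply/cauchy_cvgP/cauchy_ballP => e e0.
  have [|n0 h] := cu (complex.Re e); first by move: e0; rewrite ltcE => /andP[].
  have eR : e = (complex.Re e)%:C%C by rewrite RRe_real// gtr0_real.
  rewrite near_map2; exists ([set n | (n0 <= n)%N], [set n | (n0 <= n)%N]) => /=.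
    by split; exists n0.
  move=> [m n] [/= hm hn]; rewrite -ball_normE /= eR normE ltcR.
  exact: h.
move=> /cvg_ex[x /cvgrPdistC_lt h]; exists x => e e0.
have [|n0 _ hn] := h e%:C%C; first by rewrite (ltcR 0 e).
by exists n0 => n n0n; have := hn n n0n; rewrite /= normE ltcR.
Qed.

Lemma denseP S :
  dense S <-> forall x (e : R), 0 < e -> exists2 s, S s & nrm (s - x) < e.
Proof.
split=> [dS x e e0|h O [x Ox] oO].
  have [|s [bs Ss]] := dS (ball x e%:C%C) _ (ball_open _ _).
  - by exists x; apply: ballxx; rewrite (ltcR 0 e).

  exists s => //; move: bs; rewrite -ball_normE /= normE ltcR.
  by rewrite nrmB.
have /nbhs_ballP[e /= e0 he] : nbhs x O by exact: open_nbhs_nbhs.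
have eR : e = (complex.Re e)%:C%C by rewrite RRe_real// gtr0_real.
have [|s Ss hs] := h x (complex.Re e); first by move: e0; rewrite ltcE => /andP[].
exists s; split=> //; apply: he; rewrite -ball_normE /= normE eR ltcR.
by rewrite nrmB.
Qed.

End RealDot.

(** * Uniform boundedness and Riesz representation *)

Section UniformBoundedness.
Context {R : realType} {E : lmodType R[i]}.
Variables (D : set E) (N : E -> R).

Definition real_subspace (S : set E) :=
  S 0 /\ forall (a : R) x y, S x -> S y -> S (a%:C%C *: x + y).

Definition semi_norm_on :=
  [/\ forall x, D x -> 0 <= N x,
      forall x y, D x -> D y -> N (x + y) <= N x + N y
    & forall (a : R) x, D x -> N (a%:C%C *: x) = `|a| * N x].

(** Sequences run in [S], limits lie in [D]: Riesz representation is applied to subspaces [S] that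
    are not closed, with a larger [D] to hold the limits. *)
Definition complete_for (S : set E) :=
  forall u, (forall n, S (u n)) -> cauchy_for N u ->
    exists2 x, D x & tends_for N u x.

Hypothesis subD : real_subspace D.
Hypothesis normN : semi_norm_on.

Lemma real_subspaceD S x y : real_subspace S -> S x -> S y -> S (x + y).
Proof. by move=> [_ h] Sx Sy; have := h 1 x y Sx Sy; rewrite scale1r. Qed.

Lemma real_subspaceZ S a x : real_subspace S -> S x -> S (a%:C%C *: x).
Proof. by move=> [S0 h] Sx; have := h a x 0 Sx S0; rewrite addr0. Qed.

Lemma real_subspaceN S x : real_subspace S -> S x -> S (- x).
Proof.
move=> sS Sx; have := real_subspaceZ (-1) sS Sx.
by rewrite rmorphN1 scaleN1r.
Qed.

Lemma real_subspaceB S x y : real_subspace S -> S x -> S y -> S (x - y).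
Proof. by move=> sS Sx Sy; apply: real_subspaceD => //; exact: real_subspaceN. Qed.

Let N_ge0 x : D x -> 0 <= N x. Proof. by case: normN => h _ _; exact: h. Qed.
Let ND x y : D x -> D y -> N (x + y) <= N x + N y.
Proof. by case: normN => _ h _; exact: h. Qed.
Let NZ a x : D x -> N (a%:C%C *: x) = `|a| * N x.
Proof. by case: normN => _ _; exact. Qed.
Let NN x : D x -> N (- x) = N x.
Proof. by move=> Dx; rewrite -scaleN1r -(rmorphN1 (real_complex R)) NZ// normrN1 mul1r. Qed.

Let N0 : N 0 = 0.
Proof. by have := @NZ 0 0 (proj1 subD); rewrite rmorph0 scale0r normr0 mul0r. Qed.

Let NBC x y : D x -> D y -> N (x - y) = N (y - x).
Proof. by move=> Dx Dy; rewrite -(NN (real_subspaceB subD Dx Dy)) opprB. Qed.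

Let NDB x y z : D x -> D y -> D z -> N (x - z) <= N (x - y) + N (y - z).
Proof.
move=> Dx Dy Dz; have -> : x - z = (x - y) + (y - z) by rewrite addrA subrK.
by apply: ND; exact: real_subspaceB.
Qed.

Hypothesis complD : complete_for D.
Context {I : Type} (f : I -> E -> R) (b : I -> R).
Hypothesis b_ge0 : forall i, 0 <= b i.
Hypothesis linf : forall i, real_linear (f i).
Hypothesis bndf : forall i, exists c, forall x, D x -> `|f i x| <= c * N x.
Hypothesis ptf : forall x, D x -> exists c, forall i, `|f i x| <= c * b i.

(* A ball of the nested sequence of Baire's argument: half the radius of the
   old ball is used to move the centre, a quarter is kept. *)
Let shrunk (n : nat) (p q : E * R) :=
  [/\ D q.1, (0 : R) < q.2, q.2 <= p.2 / 4, N (q.1 - p.1) <= p.2 / 2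
    & exists i, forall y, D y -> N (y - q.1) <= q.2 -> n%:R * b i < `|f i y|].

Let shrink :
  (forall c : R, 0 <= c -> exists i x, D x /\ c * b i * N x < `|f i x|) ->
  forall n (p : E * R), D p.1 -> (0 : R) < p.2 -> exists q, shrunk n p q.
Proof.
move=> unb n [x r]/= Dx r0.
have [|i [z [Dz hz]]] := unb (2 * n%:R / r).
  by rewrite divr_ge0 ?mulr_ge0// ltW.
have [c hc] := bndf i.
have Nz : 0 < N z.
  rewrite lt_def N_ge0// andbT; apply/eqP => z0; have := hc z Dz.
  by move: hz; rewrite z0 !mulr0 => hz; rewrite leNgt hz.
(* [t * z] has norm [r / 2], the allowed displacement of the centre. *)
pose t := r / (2 * N z).
have t0 : 0 < t by rewrite divr_gt0// mulr_gt0.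
have fz : 2 * n%:R * b i < 2 * `|t * f i z|.
  rewrite normrM (gtr0_norm t0).
  have -> : 2 * (t * `|f i z|) = (r / N z) * `|f i z| by rewrite /t; field; lra.
  rewrite -(ltr_pM2l (divr_gt0 r0 Nz)) in hz.
  apply: le_lt_trans hz; rewrite le_eqVlt; apply/orP; left; apply/eqP.
  by field; rewrite !gt_eqF.
(* The values of [f i] at [x + t z] and [x - t z] differ by more than [2 * n%:R * b i], so one of
   them exceeds [n%:R * b i] in absolute value. *)
have [s [s1 hs]] : exists s : R, `|s| = 1 /\ n%:R * b i < `|f i (x + (s * t)%:C%C *: z)|.
  have e1 : f i (x + (1 * t)%:C%C *: z) = f i x + t * f i z.
    by rewrite (real_linearD (linf i)) (real_linearZ (linf i)) mul1r.
  have e2 : f i (x + (-1 * t)%:C%C *: z) = f i x - t * f i z.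
    by rewrite (real_linearD (linf i)) (real_linearZ (linf i)) mulN1r mulNr.
  have [h|h] := ltP (n%:R * b i) `|f i (x + (1 * t)%:C%C *: z)|.
    by exists 1; rewrite normr1.
  exists (-1); rewrite normrN1; split=> //.
  have := ler_normB (f i (x + (1 * t)%:C%C *: z)) (f i (x + (-1 * t)%:C%C *: z)).
  have -> : f i (x + (1 * t)%:C%C *: z) - f i (x + (-1 * t)%:C%C *: z)
    = 2 * (t * f i z) by rewrite e1 e2; ring.
  rewrite normrM ger0_norm//; lra.
set x' := x + _ in hs.
have Dx' : D x' by apply: real_subspaceD => //; exact: real_subspaceZ.
pose g := `|f i x'| - n%:R * b i.
have g0 : 0 < g by rewrite subr_gt0.
(* On a ball of this radius [f i] varies by at most [g / 2], half the margin gained at the centre;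
   the 1 keeps the denominator positive. *)
pose r' := Num.min (r / 4) (g / (2 * (`|c| + 1))).
exists (x', r'); split => //=.
- by rewrite lt_min !divr_gt0// mulr_gt0// ltr_wpDl.
- by rewrite ge_min lexx.
- rewrite /x' addrAC subrr add0r NZ// normrM s1 mul1r gtr0_norm// /t.
  have -> // : r / (2 * N z) * N z = r / 2 by field; lra.
exists i => y Dy hy.
have := ler_normB (f i x' - f i y) (- f i y); rewrite opprK subrK normrN.
have := hc _ (real_subspaceB subD Dx' Dy).
rewrite (real_linearB (linf i)) NBC//.
have Nd : 0 <= N (y - x') by exact: N_ge0 (real_subspaceB subD Dy Dx').
have h1 : c * N (y - x') <= (`|c| + 1) * r'.
  apply: (@le_trans _ _ ((`|c| + 1) * N (y - x'))).
    by apply: ler_wpM2r => //; have := ler_norm c; lra.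
  by apply: ler_wpM2l => //; rewrite addr_ge0.
have h2 : (`|c| + 1) * r' <= g / 2.
  apply: (@le_trans _ _ ((`|c| + 1) * (g / (2 * (`|c| + 1))))).
    by rewrite ler_wpM2l ?addr_ge0// ge_min lexx orbT.
  have c1 : `|c| + 1 != 0 by rewrite gt_eqF// ltr_wpDl.
  by rewrite le_eqVlt; apply/orP; left; apply/eqP; field.
rewrite /g in g0 h2; lra.
Qed.

(** If no constant works, nested balls are built on which members of the family exceed [n%:R * b i]
    for growing [n]; the limit of the centres lies in all of them and contradicts [ptf]. The weights
    [b] let a family be indexed by unnormalized vectors. *)
Lemma uniform_boundedness :
  exists2 c : R, 0 <= c & forall i x, D x -> `|f i x| <= c * b i * N x.
Proof.
apply: contrapT => hno.
have unb (c : R) : 0 <= c -> exists i x, D x /\ c * b i * N x < `|f i x|.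
  move=> c0; apply: contrapT => h; apply: hno; exists c => // i x Dx.
  by rewrite leNgt; apply/negP => h'; apply: h; exists i, x.
have [F hF] : exists F : nat * (E * R) -> E * R, forall np,
    D np.2.1 -> (0 : R) < np.2.2 -> shrunk np.1 np.2 (F np).
  have [np|F hF] := @choice _ _
    (fun np q => D np.2.1 -> (0 : R) < np.2.2 -> shrunk np.1 np.2 q);
      last by exists F.
  have [[h1 h2]|h] := pselect (D np.2.1 /\ 0 < np.2.2).
    by have [q hq] := shrink unb np.1 h1 h2; exists q.
  by exists np.2 => h1 h2; exfalso; apply: h.
pose s := fix s n := if n is m.+1 then F (m, s m) else ((0 : E), (1 : R)).
have sP' n : D (s n).1 /\ (0 : R) < (s n).2.
  elim: n => [|n [h1 h2]] /=; first by split; [case: subD|].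
  by have [] := hF (n, s n) h1 h2.
pose X n : E := (s n).1; pose r n : R := (s n).2.
have sP n : D (X n) /\ 0 < r n by exact: sP'.
have sS n : [/\ D (X n.+1), 0 < r n.+1, r n.+1 <= r n / 4,
    N (X n.+1 - X n) <= r n / 2
  & exists i, forall y, D y -> N (y - X n.+1) <= r n.+1 -> n%:R * b i < `|f i y|].
  by have [h1 h2] := sP' n; exact: hF (n, s n) h1 h2.
have rad n : r n <= n.+1%:R^-1.
  elim: n => [|n ih]; first by rewrite invr1 /r.
  have [_ _ h _ _] := sS n; apply: le_trans h _.
  have n2 : (n.+2%:R : R) = n.+1%:R + 1 by rewrite -natr1.
  have n1 : (0 : R) < n.+1%:R by rewrite ltr0n.
  rewrite ler_pdivrMr//; apply: le_trans ih _.
  rewrite n2 mulrC -(ler_pM2l n1) divff ?gt_eqF//.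
  rewrite mulrA ler_pdivlMr; last by rewrite addr_gt0.
  have : (1 : R) <= n.+1%:R by rewrite ler1n.
  lra.
(* A displacement [r / 2] and a new radius at most [r / 4] stay within [r], so each ball lies in the
   preceding ones. *)
have nest n k : N (X (n + k)%N - X n) + r (n + k)%N <= r n.
  elim: k => [|k ih].
    by rewrite addn0 subrr N0 add0r.
  rewrite addnS; have [D1 p1 q1 q2 _] := sS (n + k)%N.
  have [D2 p2] := sP (n + k)%N; have [D3 p3] := sP n.
  have := NDB D1 D2 D3; lra.
have small (e : R) : 0 < e -> exists n, (n.+1%:R^-1 : R) < e.
  move=> e0; exists (Num.truncn e^-1).
  by rewrite invf_plt ?posrE ?ltr0n// truncnS_gt.
have [|x Dx hx] := complD (u := X) (fun n => (sP n).1).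
  move=> e e0; have [|n hn] := small (e / 2); first by rewrite divr_gt0.
  exists n => p q np nq; have [Dn pn] := sP n; have [Dp pp] := sP p;
    have [Dq pq] := sP q => /=.
  have := nest n (p - n)%N; have := nest n (q - n)%N; rewrite !subnKC//.
  have := le_lt_trans (rad n) hn; have := NDB Dp Dn Dq; rewrite (NBC Dn Dq); lra.
have xn n : N (x - X n) <= r n.
  apply/ler_addgt0Pr => e e0; have [n0 hn0] := hx e e0.
  have [Dn pn] := sP n; have [Dm pm] := sP (n + n0)%N.
  have := nest n n0; have /= := hn0 (n + n0)%N (leq_addl _ _).
  have := NDB Dx Dm Dn; rewrite (NBC Dx Dm); lra.
have [c hc] := ptf Dx.
have [_ _ _ _ [i hi]] := sS (Num.truncn `|c|).+1.
have := hi x Dx (xn _); have := hc i.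
suff : c * b i <= (Num.truncn `|c|).+1%:R * b i by lra.
apply: ler_wpM2r => //; apply: le_trans (ler_norm c) _.
by rewrite ltW// truncnS_gt.
Qed.

End UniformBoundedness.

Section Riesz.
Context {R : realType} {E : lmodType R[i]}.
Variables (ip : E -> E -> R) (ipP : semi_inner ip).
Local Notation N := (fun x => Num.sqrt (ip x x)).

(** This is the first-order condition at a minimum. The choice [t = - d / (q + 1)] makes the linear
    term win, the 1 covering [q = 0]. *)
Lemma vanishing_linear_term (d q : R) :
  (forall t, 0 <= 2 * t * d + t ^+ 2 * q) -> 0 <= q -> d = 0.
Proof.
move=> h q0; apply/eqP/contraT => dn0.
have q1 : q + 1 != 0 by rewrite gt_eqF// ltr_wpDl.
have := h (- d / (q + 1)).
have -> : 2 * (- d / (q + 1)) * d + (- d / (q + 1)) ^+ 2 * q =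
  - (d ^+ 2 * ((q + 2) / (q + 1) ^+ 2)) by field.
rewrite oppr_ge0 leNgt mulr_gt0// ?exprn_even_gt0// divr_gt0//.
  by rewrite ltr_wpDl.
by rewrite exprn_gt0// ltr_wpDl.
Qed.

Lemma archimedean_inv (e : R) : 0 < e -> exists n0, forall n : nat, (n0 <= n)%N ->
  n.+1%:R^-1 < e.
Proof.
move=> e0; exists (Num.truncn e^-1) => n hn.
rewrite invf_plt ?posrE ?ltr0n//; apply: lt_le_trans (truncnS_gt _) _.
by rewrite ler_nat.
Qed.

(* The functional is only given on S, which need not be complete: a sequence
   of S minimizing [ip y y - 2 f y] is Cauchy, and its limit represents f. *)
Lemma riesz (S D : set E) (f : E -> R) (c : R) :
  real_subspace S -> complete_for D N S -> real_linear f -> 0 <= c ->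
  (forall y, S y -> f y ^+ 2 <= c * ip y y) ->
  exists z, [/\ D z, forall y, S y -> f y = ip y z & ip z z <= c].
Proof.
move=> subS compl lf c0 bf.
pose J y := ip y y - 2 * f y.
have J_ge y : S y -> - c <= J y.
  move=> Sy; have := bf y Sy; have := si_ge0 ipP y; rewrite /J.
  set q := ip y y; set a := f y => q0 h.
  have : 2 * a <= q + c; last by lra.
  apply: le_trans (ler_norm _) _.
  rewrite -(@ler_pXn2r _ 2) ?nnegrE ?addr_ge0// real_normK ?num_real//.
  have : 0 <= (q - c) ^+ 2 by exact: sqr_ge0.
  lra.
pose m := inf (J @` S).
have hasm : has_inf (J @` S).
  split; first by exists (J 0), 0 => //; case: subS.
  by exists (- c) => _ [y Sy <-]; exact: J_ge.
have m_le y : S y -> m <= J y.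
  by move=> Sy; apply: ge_inf; [case: hasm|exists y].
have [u hu] : exists u : nat -> E, forall n, S (u n) /\ J (u n) < m + n.+1%:R^-1.
  have [n|u hu] := @choice _ _ (fun n y => S y /\ J y < m + n.+1%:R^-1);
    last by exists u.
  have [|_ [y Sy <-] hy] := @inf_adherent _ (J @` S) n.+1%:R^-1 _ hasm.
    by rewrite invr_gt0.
  by exists y.
have Ju (e : R) : 0 < e -> exists n0, forall n, (n0 <= n)%N -> J (u n) < m + e.
  move=> /archimedean_inv[n0 hn0]; exists n0 => n /hn0 h.
  by apply: lt_trans (hu n).2 _; rewrite ltrD2l.
(* Parallelogram law: the midpoint of [x] and [y] also lies in [S], so [J] there is at least [m]. *)
have par x y : S x -> S y -> ip (x - y) (x - y) <= 2 * (J x - m) + 2 * (J y - m).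
  move=> Sx Sy; have := m_le _ (real_subspaceZ (2^-1) subS (real_subspaceD subS Sx Sy)).
  rewrite /J (real_linearZ lf) (real_linearD lf) !(siE ipP) (siC ipP y x).
  set a := ip x x; set b := ip y y; set d := ip x y; set e := f x; set g := f y.
  lra.
have [|z Dz hz] := compl u (fun n => (hu n).1).
  move=> e e0.
  have [|n0 hn0] := Ju (e ^+ 2 / 4); first by rewrite divr_gt0// exprn_gt0.
  exists n0 => p q hp hq.
  rewrite -(@ltr_pXn2r _ 2) ?nnegrE ?sqrtr_ge0 ?ltW// sqr_sqrtr ?(si_ge0 ipP)//.
  have := par _ _ (hu p).1 (hu q).1; have := hn0 _ hp; have := hn0 _ hq; lra.
have fz y : S y -> f y = ip y z.
  move=> Sy; apply/eqP; rewrite eq_sym -subr_eq0; apply/eqP.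
  apply: (@vanishing_linear_term _ (ip y y)); last exact: si_ge0.
  (* [J (u n + t y)] is at least [m], and [n] is taken so large that [J (u n)] exceeds [m] by less
     than [e / 2] and that replacing [u n] by [z] in the linear term costs at most [e / 2]. *)
  move=> t; apply/ler_addgt0Pr => e e0.
  pose k := 2 * `|t| * N y + 1.
  have k0 : 0 < k by rewrite ltr_wpDl// !mulr_ge0// sqrtr_ge0.
  have [|n1 hn1] := Ju (e / 2); first by rewrite divr_gt0.
  have [|n2 hn2] := hz (e / (2 * k)); first by rewrite divr_gt0// mulr_gt0.
  pose n := maxn n1 n2.
  have [Sn _] := hu n.
  have := hn1 n (leq_maxl _ _); have := hn2 n (leq_maxr _ _) => h2 Jn.
  have := m_le _ (real_subspaceD subS Sn (real_subspaceZ t subS Sy)).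
  move: Jn; rewrite /J (real_linearD lf) (real_linearZ lf) !(siE ipP) (siC ipP y (u n)).
  have e1 : 2 * t * (ip (u n) y - ip y z) <= e / 2.
    apply: le_trans (ler_norm _) _; rewrite !normrM (siC ipP (u n)) -(siBr ipP).
    rewrite (ger0_norm (ler0n R 2)).
    have := si_cauchy_schwarz_sqrt ipP y (u n - z) => h3.
    apply: (@le_trans _ _ (2 * `|t| * (N y * N (u n - z)))).
      by rewrite ler_wpM2l// mulr_ge0.
    rewrite mulrA; apply: (@le_trans _ _ (k * N (u n - z))).
      by apply: ler_wpM2r; rewrite ?sqrtr_ge0// /k lerDl.
    apply: (@le_trans _ _ (k * (e / (2 * k)))).
      by rewrite ler_pM2l// ltW.
    by rewrite le_eqVlt; apply/orP; left; apply/eqP; field; rewrite gt_eqF.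
  lra.
exists z; split => //.
set s := N z; set k := Num.sqrt c.
have s0 : 0 <= s by exact: sqrtr_ge0.
have k0 : 0 <= k by exact: sqrtr_ge0.
have ss : ip z z = s ^+ 2 by rewrite sqr_sqrtr// (si_ge0 ipP).
(* The bound [bf] does not apply to [z], which may lie outside [S]; the inequality is the limit of
   [|f (u n)| <= k * N (u n)]. *)
suff h : s ^+ 2 <= k * s.
  have : s <= k.
    have [->//|sn0] := eqVneq s 0.
    have sp : 0 < s by rewrite lt_def sn0.
    by rewrite -(ler_pM2r sp) -expr2.
  by rewrite ss -(sqr_sqrtr c0) -/k => h1; rewrite ler_pXn2r.
apply/ler_addgt0Pr => e e0.
have sk : 0 < s + k + 1 by rewrite ltr_wpDl// addr_ge0.
have [|n hn] := hz (e / (s + k + 1)); first by rewrite divr_gt0.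
have {hn} := hn n (leqnn _); set d := u n - z => hd.
have [Sn _] := hu n.
have un : u n = z + d by rewrite /d addrC subrK.
have h1 : `|f (u n)| <= k * N (u n).
  rewrite -(@ler_pXn2r _ 2)// ?nnegrE ?mulr_ge0 ?sqrtr_ge0//.
  by rewrite real_normK ?num_real// exprMn !sqr_sqrtr ?(si_ge0 ipP)//; exact: bf.
have h2 : N (u n) <= s + N d by rewrite un; exact: si_triangle.
have h3 : k * N (u n) <= k * (s + N d) by rewrite ler_wpM2l.
have h4 := si_cauchy_schwarz_sqrt ipP d z.
move: h1; rewrite fz// {1}un (siDl ipP) ss => h1.
have h5 : (s + k) * N d <= e.
  apply: (@le_trans _ _ ((s + k + 1) * N d)).
    by apply: ler_wpM2r; rewrite ?sqrtr_ge0// lerDl.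
  by rewrite mulrC -ler_pdivlMr// ltW.
have h6 := ler_normB (s ^+ 2 + ip d z) (ip d z); rewrite addrK in h6.
have := ler_norm (s ^+ 2); rewrite -/s in h4; lra.
Qed.

End Riesz.

Section HilbertLemmas.
Context {R : realType} {V : hilbertType R}.
Implicit Types (x y z : V) (S : set V) (K Q : {linear V -> V}).

Lemma rdot_linear z : real_linear (rdot^~ z).
Proof. by case: (@rdot_semi_inner R V) => h _ _; exact: h. Qed.

Lemma rdot_linear_r z : real_linear (rdot z).
Proof. by move=> a x y; rewrite !(rdotC z); exact: rdot_linear. Qed.

Lemma rdot_map_linear K z : real_linear (fun x => rdot (K x) z).
Proof. by move=> a x y; rewrite linearP; exact: rdot_linear. Qed.

Lemma nrm_semi_norm S : semi_norm_on S nrm.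
Proof.
split=> *; [exact: nrm_ge0|exact: nrmD|exact: nrmZ].
Qed.

Lemma real_subspaceT (E : lmodType R[i]) : real_subspace (@setT E).
Proof. by split. Qed.

Lemma complete_nrm S : complete_for setT nrm S.
Proof. by move=> u _ /hilbert_complete[x hx]; exists x. Qed.

(** Banach-Steinhaus for the functionals [rdot (L i)]; evaluation at [L i] itself recovers the
    norm. *)
Lemma weakly_bounded_family (J : Type) (L : J -> V) (b : J -> R) :
  (forall i, 0 <= b i) ->
  (forall z, exists c, forall i, `|rdot (L i) z| <= c * b i) ->
  exists2 c : R, 0 <= c & forall i, nrm (L i) <= c * b i.
Proof.
move=> b0 h.
have [||c c0 hc] := uniform_boundedness (real_subspaceT V) (nrm_semi_norm setT)
  (@complete_nrm setT) b0 (fun i => rdot_linear_r (L i)).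
- by move=> i; exists (nrm (L i)) => x _; exact: nrm_dot.
- by move=> z _; exact: h.
exists c => // i; have := hc i (L i) I; rewrite rdot_nrm.
rewrite ger0_norm ?sqr_ge0// expr2.
have [->|n0] := eqVneq (nrm (L i)) 0; first by rewrite mulr_ge0.
by rewrite ler_pM2r// lt_def n0 nrm_ge0.
Qed.

(** Testing with [k] itself would give [nrm k ^+ 2 <= c * nrm k]; density supplies a [w] close to
    [k], with an arbitrarily small error. *)
Lemma dense_dual_norm S k (c : R) : dense S -> 0 <= c ->
  (forall w, S w -> rdot k w <= c * nrm w) -> nrm k <= c.
Proof.
move=> /denseP dS c0 h.
suff h1 : nrm k ^+ 2 <= c * nrm k.
  have [->//|n0] := eqVneq (nrm k) 0.
  have kp : 0 < nrm k by rewrite lt_def n0 nrm_ge0.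
  by rewrite -(ler_pM2r kp) -expr2.
apply/ler_addgt0Pr => e e0.
have p0 : 0 < c + nrm k + 1 by rewrite ltr_wpDl// addr_ge0// nrm_ge0.
have [|w Sw hw] := dS k (e / (c + nrm k + 1)); first by rewrite divr_gt0.
have := h w Sw; have := nrmD k (w - k); rewrite addrC subrK => h1 h2.
have := rdot_le k (k - w); rewrite nrmB -rdot_nrm (siBr rdot_semi_inner) => h3.
have h4 : c * nrm w <= c * (nrm k + nrm (w - k)) by rewrite ler_wpM2l.
have h5 : (c + nrm k) * nrm (w - k) <= e.
  apply: (@le_trans _ _ ((c + nrm k + 1) * nrm (w - k))).
    by apply: ler_wpM2r; rewrite ?nrm_ge0// lerDl.
  by rewrite mulrC -ler_pdivlMr// ltW.
lra.
Qed.

(* Hellinger-Toeplitz *)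
Lemma formal_adjoint_bounded K S : dense S ->
  (forall z, S z -> exists w, forall x, rdot (K x) z = rdot x w) ->
  exists2 c : R, 0 <= c & forall x, nrm (K x) <= c * nrm x.
Proof.
(* The functionals are indexed by the [z] in [S], with weight [nrm z]: each is bounded through its
   formal adjoint, and at a fixed [x] all are controlled by [nrm (K x)]. *)
move=> dS h; pose f (i : {z | S z}) x := rdot (K x) (sval i).
have [||||c c0 hc] := @uniform_boundedness _ _ _ _ (real_subspaceT V)
  (nrm_semi_norm setT) (@complete_nrm setT) _ f (fun i => nrm (sval i)).
- by move=> i; exact: nrm_ge0.
- by move=> i; exact: rdot_map_linear.
- move=> [z Sz]; have [w hw] := h z Sz; exists (nrm w) => x _.
  by rewrite /f/= hw mulrC; exact: nrm_dot.
- by move=> x _; exists (nrm (K x)) => i; exact: nrm_dot.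
exists c => // x; apply: (dense_dual_norm dS).
  by rewrite mulr_ge0// nrm_ge0.
move=> w Sw; have := hc (exist _ w Sw) x I; rewrite /f/= => h1.
by apply: le_trans (ler_norm _) _; rewrite mulrAC.
Qed.

Lemma dense_of_orthogonal S : real_subspace S ->
  (forall x, (forall y, S y -> rdot y x = 0) -> x = 0) -> dense S.
Proof.
move=> sS h; apply/denseP => x.
(* [D] is the closure of [S]; the representative found in it is the orthogonal projection of [x]. *)
pose D := [set z | forall e : R, 0 < e -> exists2 s, S s & nrm (s - z) < e].
have [||||z [Dz hz _]] := @riesz _ _ _ (@rdot_semi_inner R V) S D (rdot^~ x) (rdot x x) sS.
- move=> u Su /hilbert_complete[z hz]; exists z => // e /hz[n hn].
  by exists (u n) => //; exact: hn.
- exact: rdot_linear.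
- exact: rdot_ge0.
- by move=> y _; rewrite mulrC; exact: si_cauchy_schwarz rdot_semi_inner _ _.
suff -> : x = z by exact: Dz.
apply/eqP; rewrite -subr_eq0; apply/eqP; apply: h => y Sy.
by rewrite (siBr rdot_semi_inner) hz// subrr.
Qed.

Lemma bounded_adjoint K (c : R) : (forall x, nrm (K x) <= c * nrm x) ->
  exists K' : V -> V, forall x y, rdot (K x) y = rdot x (K' y).
Proof.
move=> hc; suff /choice[K' hK'] : forall y, exists z, forall x,
  rdot (K x) y = rdot x z by exists K' => x y; exact: hK'.
move=> y.
have [||||z [_ hz _]] := @riesz _ _ _ (@rdot_semi_inner R V) setT setT
  (fun x => rdot (K x) y) ((c * nrm y) ^+ 2) (real_subspaceT _).
- exact: complete_nrm.
- exact: rdot_map_linear.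
- exact: sqr_ge0.
- move=> x _; rewrite rdot_nrm -exprMn -[leLHS]real_normK ?num_real//.
  have h : `|rdot (K x) y| <= c * nrm y * nrm x.
    by apply: le_trans (nrm_dot _ _) _; rewrite mulrAC ler_wpM2r// nrm_ge0.
  by rewrite ler_pXn2r// nnegrE//; exact: le_trans h.
by exists z => x; exact: hz.
Qed.

Lemma linear_of_graph (F : set (V * V)) : linear_operator F -> dom F = setT ->
  exists f : {linear V -> V}, forall x y, F (x, y) <-> y = f x.
Proof.
move=> [F0 Fl Fu] FT.
have /choice[f hf] : forall x, exists y, F (x, y).
  by move=> x; have : dom F x by rewrite FT.
have fun_F x y y' : F (x, y) -> F (x, y') -> y = y'.
  move=> h h'; apply/eqP; rewrite -subr_eq0; apply/eqP; apply: Fu.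
  by have := Fl (-1) _ _ _ _ h' h; rewrite !scaleN1r addNr addrC.
have lf : linear f by move=> a x y;
  apply: fun_F (hf _) (Fl _ _ _ _ _ (hf x) (hf y)).
pose fM := GRing.isLinear.Build _ _ _ _ f lf.
pose fL : {linear V -> V} := HB.pack f fM.
exists fL => x y; split=> [h|->]; last exact: hf.
exact: fun_F h (hf x).
Qed.

(** The inverse of [Q] has a formal adjoint [Q' y |-> y] on the range of the adjoint [Q'], which is
    dense because [Q] is injective. Hellinger-Toeplitz then bounds the inverse. *)
Lemma bounded_inverse Q (c : R) : (forall x, nrm (Q x) <= c * nrm x) ->
  (forall x, Q x = 0 -> x = 0) -> (forall y, exists x, Q x = y) ->
  exists2 d : R, 0 <= d & forall x, nrm x <= d * nrm (Q x).
Proof.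
move=> bQ iQ sQ; have [Q' hQ'] := bounded_adjoint bQ.
have [||Qi hQi] := @linear_of_graph [set p | Q p.2 = p.1].
- split=> /=; first by rewrite linear0.
    by move=> a x x' y y' <- <-; rewrite linearP.
  by move=> y; exact: iQ.
- by apply/seteqP; split=> // x _; have [y hy] := sQ x; exists y.
have QiK x : Qi (Q x) = x by apply/esym/hQi.
have QK x : Q (Qi x) = x by have [_ h] := hQi x (Qi x); exact: h.
have [|z [y _ <-]|d d0 hd] := @formal_adjoint_bounded Qi (range Q'); last 1 first.
- by exists d => // x; rewrite -{1}(QiK x).
- apply: dense_of_orthogonal; last first.
    move=> x h; apply: iQ; apply: rdot_eq0.
    by rewrite hQ' rdotC; apply: h; exists (Q x).
  have Q'l a x y : Q' (a%:C%C *: x + y) = a%:C%C *: Q' x + Q' y.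
    by apply: rdot_orth_eq => z; rewrite -hQ' !rdotE !hQ'.
  split; first by exists 0 => //; apply: rdot_orth_eq => z; rewrite -hQ' !rdotx0.
  by move=> a _ _ [x _ <-] [y _ <-]; exists (a%:C%C *: x + y).
- by exists y => x; rewrite -hQ' QK.
Qed.

End HilbertLemmas.

(** * Unbounded operators *)

Section Operators.
Context {R : realType} {V : hilbertType R}.
Implicit Types (x y z : V) (A T L M : operator V).

Lemma tends_rdot_eq (u v : nat -> V) x y a b :
  tends_for nrm u x -> tends_for nrm v y ->
  (forall n, rdot (u n) a = rdot (v n) b) -> rdot x a = rdot y b.
Proof.
move=> ux vy h; apply/eqP; rewrite -subr_eq0 -normr_le0; apply/ler_addgt0Pr => e e0.
rewrite add0r; pose k := nrm a + nrm b + 1.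
have k0 : 0 < k by rewrite ltr_wpDl// addr_ge0// nrm_ge0.
have [|n hn] := ux (e / k); first by rewrite divr_gt0.
have [|m hm] := vy (e / k); first by rewrite divr_gt0.
have {}hn := hn _ (leq_maxl n m); have {}hm := hm _ (leq_maxr n m).
set i := maxn n m in hn hm.
have -> : rdot x a - rdot y b = rdot (v i - y) b - rdot (u i - x) a.
  by rewrite !rdotE h; ring.
apply: le_trans (ler_normB _ _) _.
have h1 := nrm_dot (v i - y) b; have h2 := nrm_dot (u i - x) a.
have h3 : nrm (v i - y) * nrm b <= e / k * nrm b.
  by rewrite ler_wpM2r ?nrm_ge0// ltW.
have h4 : nrm (u i - x) * nrm a <= e / k * nrm a.
  by rewrite ler_wpM2r ?nrm_ge0// ltW.
have h5 : e / k * (nrm a + nrm b) <= e.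
  by rewrite mulrAC ler_pdivrMr// ler_pM2l// /k lerDl.
lra.
Qed.

Lemma real_subspace_operator A : linear_operator A -> real_subspace A.
Proof.
by move=> [A0 Al _]; split=> // a [x x'] [y y'] h h'; exact: Al.
Qed.

Lemma linear_operatorZ A (a : R[i]) x y : linear_operator A ->
  A (x, y) -> A (a *: x, a *: y).
Proof.
by move=> [A0 Al _] h; have := Al a _ _ _ _ h A0; rewrite !addr0.
Qed.

Lemma linear_operatorB A x y x' y' : linear_operator A ->
  A (x, y) -> A (x', y') -> A (x - x', y - y').
Proof.
move=> [A0 Al _] h h'; have := Al (-1) _ _ _ _ h' h.
by rewrite !scaleN1r ![- _ + _]addrC.
Qed.

Lemma operator_functional A x y y' : linear_operator A ->
  A (x, y) -> A (x, y') -> y = y'.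
Proof.
move=> lA h h'; apply/eqP; rewrite -subr_eq0; apply/eqP.
case: (lA) => _ _; apply; have := linear_operatorB lA h h'; by rewrite subrr.
Qed.

Lemma adjointP A p q : linear_operator A ->
  adjoint A (p, q) <-> forall x y, A (x, y) -> rdot y p = rdot x q.
Proof.
move=> lA; split=> [h x y /h/= e|h x y Axy]; first by rewrite /rdot e.
apply: inner_rdot_eq; apply: h => //; exact: linear_operatorZ.
Qed.

Definition closed_operator A := forall u v x y, (forall n, A (u n, v n)) ->
  tends_for nrm u x -> tends_for nrm v y -> A (x, y).

Lemma closed_adjoint A : linear_operator A -> closed_operator (adjoint A).
Proof.
move=> lA u v x y h ux vy; apply/adjointP => // a b Aab.
rewrite (rdotC b) (rdotC a); apply: tends_rdot_eq ux vy _ => n.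
by have /adjointP/(_ a b Aab) := h n; rewrite !(rdotC _ (u n)) !(rdotC _ (v n));
  apply.
Qed.

Lemma self_adjoint_closed A : self_adjoint A -> closed_operator A.
Proof. by move=> [lA _ eA]; rewrite eA; exact: closed_adjoint. Qed.

Lemma self_adjoint_sym A x y z w : self_adjoint A ->
  A (x, y) -> A (z, w) -> rdot y z = rdot x w.
Proof.
by move=> [lA _ eA] h; rewrite {1}eA => /adjointP; apply.
Qed.

Lemma self_adjoint_mem A p q : self_adjoint A ->
  (forall x y, A (x, y) -> rdot y p = rdot x q) -> A (p, q).
Proof. by move=> [lA _ eA] h; rewrite eA; exact/adjointP. Qed.

Lemma op_positive_rdot A x y : op_positive A -> A (x, y) -> 0 <= rdot y x.
Proof. by move=> pA /pA; rewrite lecE => /andP[]. Qed.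

(** In [R[i]], [0 <= '[y, x]] also asserts that the number is real; this comes from symmetry tested
    on [i x] and [x]. *)
Lemma op_positive_of_sym A : linear_operator A ->
  (forall x y z w, A (x, y) -> A (z, w) -> rdot y z = rdot x w) ->
  (forall x y, A (x, y) -> 0 <= rdot y x) -> op_positive A.
Proof.
move=> lA sA pA x y Axy; rewrite lecE pA// andbT; apply/eqP.
have := sA _ _ _ _ (linear_operatorZ 'i%C lA Axy) Axy.
have := Im_inner y x; have := Im_inner x y.
rewrite (inner_conj x y); case: (inner y x) => a b /=; lra.
Qed.

Lemma dense_orthogonal (S : set V) y : dense S ->
  (forall x, S x -> rdot x y = 0) -> y = 0.
Proof.
move=> dS h; apply: nrm_eq0; apply/eqP; rewrite eq_le nrm_ge0 andbT.
by apply: (dense_dual_norm dS) => // w Sw; rewrite rdotC h// mul0r.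
Qed.

Lemma linear_adjoint A : dense (dom A) -> linear_operator A ->
  linear_operator (adjoint A).
Proof.
move=> dA lA; split.
- by apply/adjointP => // x y _; rewrite !rdotx0.
- move=> a x x' y y' h h' p q Apq /=.
  by rewrite !linearDr !linearZr_LR/= (h _ _ Apq) (h' _ _ Apq).
- move=> y /adjointP h; apply: (dense_orthogonal dA) => x [x' Ax].
  by rewrite -(h lA _ _ Ax) rdotx0.
Qed.

Definition graph_dot (p q : V * V) := rdot p.1 q.1 + rdot p.2 q.2.

Lemma graph_dot_semi_inner : semi_inner graph_dot.
Proof.
split.
- by move=> z a x y; rewrite /graph_dot/= !rdot_linear; ring.
- by move=> x y; rewrite /graph_dot rdotC (rdotC x.2).
- by move=> x; rewrite addr_ge0// rdot_ge0.
Qed.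

Local Notation gnrm := (fun p => Num.sqrt (graph_dot p p)).

Lemma nrm_le_graph (p : V * V) : nrm p.1 <= gnrm p /\ nrm p.2 <= gnrm p.
Proof.
by split; rewrite ler_sqrt ?addr_ge0 ?rdot_ge0// ?lerDl ?lerDr rdot_ge0.
Qed.

Lemma graph_le_nrm (p : V * V) : gnrm p <= nrm p.1 + nrm p.2.
Proof.
rewrite -(@ler_pXn2r _ 2)// ?nnegrE ?addr_ge0 ?sqrtr_ge0 ?nrm_ge0//.
rewrite sqr_sqrtr ?addr_ge0 ?rdot_ge0// /graph_dot !rdot_nrm sqrrD.
have : 0 <= nrm p.1 * nrm p.2 by rewrite mulr_ge0// nrm_ge0.
lra.
Qed.

Lemma tends_pair (u : nat -> V * V) x y : tends_for nrm (fst \o u) x ->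
  tends_for nrm (snd \o u) y -> tends_for gnrm u (x, y).
Proof.
move=> hx hy e e0.
have [|n hn] := hx (e / 2); first by rewrite divr_gt0.
have [|m hm] := hy (e / 2); first by rewrite divr_gt0.
exists (maxn n m) => k; rewrite geq_max => /andP[/hn h1 /hm h2].
by have /= := graph_le_nrm (u k - (x, y)); move: h1 h2 => /=; lra.
Qed.

Lemma complete_graph A : closed_operator A -> complete_for A gnrm A.
Proof.
move=> cA u Au cu.
have [|x hx] := @hilbert_complete _ V (fst \o u).
  move=> e /cu[n hn]; exists n => p q hp hq; apply: le_lt_trans (hn p q hp hq).
  by case: (nrm_le_graph (u p - u q)).
have [|y hy] := @hilbert_complete _ V (snd \o u).
  move=> e /cu[n hn]; exists n => p q hp hq; apply: le_lt_trans (hn p q hp hq).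
  by case: (nrm_le_graph (u p - u q)).
exists (x, y); last exact: tends_pair.
by apply: cA hx hy => n /=; rewrite -surjective_pairing.
Qed.

(** Von Neumann's argument: represent [(x, y) |-> <x, z>] in the graph inner product by some
    [(u, v)]. Then [<y, v> = <x, z - u>] on the graph, which says that [A^* v = z - u]. *)
Lemma one_plus_adjoint_onto A z : linear_operator A -> closed_operator A ->
  exists u v w, [/\ A (u, v), adjoint A (v, w) & u + w = z].
Proof.
move=> lA cA.
have [||||[u v] [/= Auv h _]] := @riesz _ _ _ graph_dot_semi_inner A A
  (fun p => rdot p.1 z) (rdot z z) (real_subspace_operator lA).
- exact: complete_graph.
- by move=> a x y; exact: rdot_linear.
- exact: rdot_ge0.
- move=> p _; apply: le_trans (si_cauchy_schwarz rdot_semi_inner _ _) _.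
  by rewrite mulrC ler_wpM2l ?rdot_ge0// lerDl rdot_ge0.
exists u, v, (z - u); split=> //; last by rewrite addrC subrK.
apply/adjointP => // x y Axy.
by have := h _ Axy; rewrite /graph_dot/= !rdotE; lra.
Qed.

(** For [(y, y')] in the adjoint, solve [z + L z = y + y']; then [y - z] is orthogonal to the range
    of [1 + L], hence zero. Density of the domain comes from the same surjectivity. *)
Lemma self_adjoint_of_onto L : linear_operator L ->
  (forall x y z w, L (x, y) -> L (z, w) -> rdot y z = rdot x w) ->
  (forall x y, L (x, y) -> 0 <= rdot y x) ->
  (forall z, exists u w, L (u, w) /\ u + w = z) -> self_adjoint L.
Proof.
move=> lL sL pL oL; split=> //.
  apply: dense_of_orthogonal => [|x h].
    split; first by exists 0; case: lL.
    by move=> a x y [x' hx] [y' hy]; exists (a%:C%C *: x' + y');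
      case: lL => _ + _; exact.
  have [u [w [Luw uw]]] := oL x.
  have u0 : u = 0.
    apply: rdot_eq0; have := h u (ex_intro _ w Luw); have := pL _ _ Luw.
    by rewrite -uw rdotE (rdotC u w); have := rdot_ge0 u; lra.
  move: Luw uw; rewrite u0 add0r => L0 <-; by case: lL => _ _; apply.
apply/seteqP; split=> [[x y] Lxy|[y y'] /adjointP h].
  by apply/adjointP => // z w Lzw; exact: sL Lzw Lxy.
have [z [w [Lzw zw]]] := oL (y + y').
suff yz : y = z by move: zw; rewrite yz => /addrI <-.
apply/eqP; rewrite -subr_eq0; apply/eqP.
have [u [v [Luv uv]]] := oL (y - z).
apply: rdot_eq0; rewrite -{1}uv.
have := h lL _ _ Luv; have := sL _ _ _ _ Luv Lzw.
have -> : y' = z + w - y by rewrite zw addrC addKr.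
by rewrite !rdotE; lra.
Qed.

Lemma adjoint_comp_self_adjoint A : linear_operator A -> dense (dom A) ->
  closed_operator A ->
  self_adjoint (op_comp (adjoint A) A) /\ op_positive (op_comp (adjoint A) A).
Proof.
move=> lA dA cA; have lA' := linear_adjoint dA lA.
set L := op_comp _ _.
have lL : linear_operator L.
  split; first by exists 0; [case: lA|case: lA'].
    move=> a x x' y y' [u /= h1 h2] [v /= h3 h4]; exists (a *: u + v) => /=.
      by case: lA => _ + _; apply.
    by case: lA' => _ + _; apply.
  move=> y [u /= h1 h2]; have u0 : u = 0 by case: lA => _ _; apply.
  by move: h2; rewrite u0; case: lA' => _ _; apply.
have form x y z w : L (x, y) -> L (z, w) ->
    exists a b, [/\ rdot y z = rdot a b, rdot x w = rdot a b & A (x, a) /\ A (z, b)].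
  move=> [a /= h1 h2] [b /= h3 h4]; exists a, b; split=> //.
    by have /adjointP := h2 => /(_ lA _ _ h3) e; rewrite (rdotC y) -e rdotC.
  by have /adjointP := h4 => /(_ lA _ _ h1).
have sL x y z w : L (x, y) -> L (z, w) -> rdot y z = rdot x w.
  by move=> h h'; have [a [b [-> ->]]] := form _ _ _ _ h h'.
have pL x y : L (x, y) -> 0 <= rdot y x.
  move=> h; have [a [b [-> _ [ha hb]]]] := form _ _ _ _ h h.
  by rewrite (operator_functional lA ha hb) rdot_ge0.
split; last exact: op_positive_of_sym.
apply: self_adjoint_of_onto => // z.
have [u [v [w [h1 h2 h3]]]] := one_plus_adjoint_onto z lA cA.
by exists u, w; split=> //; exists v.
Qed.

(** No factorization of [M] is at hand here. By positivity [|x + M x|] dominates [|x|] and [|M x|],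
    so the graph is complete for it; a vector [d] orthogonal to the range of [1 + M] satisfies
    [M d = - d] and vanishes by positivity. *)
Lemma one_plus_self_adjoint_onto M z : self_adjoint M -> op_positive M ->
  exists u w, M (u, w) /\ u + w = z.
Proof.
move=> sM pM; have lM : linear_operator M by case: sM.
pose ip (p q : V * V) := rdot (p.1 + p.2) (q.1 + q.2).
have ipP : semi_inner ip.
  split; last by move=> x; exact: rdot_ge0.
  - by move=> p a x y; rewrite /ip /= !rdotE; ring.
  - by move=> x y; exact: rdotC.
have le1 p : M p -> nrm p.1 <= nrm (p.1 + p.2) /\ nrm p.2 <= nrm (p.1 + p.2).
  case: p => x y /= Mp; have h1 := op_positive_rdot pM Mp.
  have h2 := rdot_ge0 x; have h3 := rdot_ge0 y.
  by split; rewrite ler_sqrt ?rdot_ge0// !rdotE (rdotC x y); lra.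
have [||||[u w] [/= Muw h _]] := @riesz _ _ _ ipP M M
  (fun p => rdot (p.1 + p.2) z) (rdot z z) (real_subspace_operator lM).
- move=> s Ms cs.
  have Md p q : M (s p - s q).
    have := Ms p; have := Ms q; case: (s p) (s q) => [a b] [c d] h h'.
    exact: linear_operatorB h' h.
  have [|x hx] := @hilbert_complete _ V (fst \o s).
    move=> e /cs[n hn]; exists n => p q hp hq; apply: le_lt_trans (hn p q hp hq).
    by case: (le1 _ (Md p q)).
  have [|y hy] := @hilbert_complete _ V (snd \o s).
    move=> e /cs[n hn]; exists n => p q hp hq; apply: le_lt_trans (hn p q hp hq).
    by case: (le1 _ (Md p q)).
  exists (x, y).
    by apply: self_adjoint_closed hx hy => // n /=; rewrite -surjective_pairing.
  move=> e e0.
  have [|n hn] := hx (e / 2); first by rewrite divr_gt0.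
  have [|m hm] := hy (e / 2); first by rewrite divr_gt0.
  exists (maxn n m) => k; rewrite geq_max => /andP[/hn h1 /hm h2].
  by have /= := nrmD ((s k).1 - x) ((s k).2 - y); move: h1 h2 => /=;
    rewrite /ip/= -/(nrm _); lra.
- by move=> a x y /=; rewrite !rdotE; ring.
- exact: rdot_ge0.
- by move=> p _; rewrite mulrC; exact: si_cauchy_schwarz rdot_semi_inner _ _.
exists u, w; split=> //; apply/eqP; rewrite eq_sym -subr_eq0; apply/eqP.
set d := z - _.
have Md : M (d, - d).
  apply: self_adjoint_mem => // x y Mxy.
  by have := h _ Mxy; rewrite /ip/= /d !rdotE; lra.
apply: rdot_eq0; have := op_positive_rdot pM Md; have := rdot_ge0 d.
by rewrite (siNl rdot_semi_inner); lra.
Qed.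

Lemma adjoint_comp_rdot A u v w x y : linear_operator A ->
  adjoint A (v, w) -> A (x, y) ->
  rdot (u + w) x = rdot u x + rdot v y.
Proof.
move=> lA /adjointP h Axy; rewrite rdotE; congr (_ + _).
by rewrite rdotC -(h lA _ _ Axy) rdotC.
Qed.

(** With [z = u + w], the vector [u] is [(1 + A^* A)^-1 z]. Together with its converse
    [dom_of_bound], this determines the domain of a closed [A] from [A^* A] alone. *)
Lemma dom_bound A x y : linear_operator A -> A (x, y) ->
  forall u v w, A (u, v) -> adjoint A (v, w) ->
  rdot (u + w) x ^+ 2 <= (rdot x x + rdot y y) * rdot (u + w) u.
Proof.
move=> lA Axy u v w Auv Avw.
rewrite (adjoint_comp_rdot _ lA Avw Axy) (adjoint_comp_rdot _ lA Avw Auv) mulrC.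
exact: (si_cauchy_schwarz graph_dot_semi_inner (u, v) (x, y)).
Qed.

(* The bound makes [u + w |-> <u + w, x>] a bounded functional for the graph
   norm of A; its representative z satisfies <u + w, x - z> = 0, and u + w
   ranges over the whole space. *)
Lemma dom_of_bound A x (c : R) : linear_operator A -> closed_operator A -> 0 <= c ->
  (forall u v w, A (u, v) -> adjoint A (v, w) ->
    rdot (u + w) x ^+ 2 <= c * rdot (u + w) u) ->
  dom A x.
Proof.
move=> lA cA c0 h.
(* A triple [((u, v), w)] carries [w = A^* v] along, which makes [<u + w, x>] linear in it, whereas
   the form sees only [(u, v)]. As [w] need not converge, [D] does not constrain it. *)
pose ip (p q : V * V * V) := graph_dot p.1 q.1.
have ipP : semi_inner ip.
  case: graph_dot_semi_inner => h1 h2 h3; split=> *; [|exact: h2|exact: h3].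
  by move=> a p q; exact: h1.
pose S : set (V * V * V) := [set p | A p.1 /\ adjoint A (p.1.2, p.2)].
pose D : set (V * V * V) := [set p | A p.1].
have [|||||[[z v] w] [/= Az hz _]] := @riesz _ _ _ ipP S D
  (fun p => rdot (p.1.1 + p.2) x) c.
- split.
    by split; [case: lA|apply/adjointP => // a b _; rewrite !rdotx0].
  move=> a [[p1 p2] p3] [[q1 q2] q3] [/= h1 h2] [/= h3 h4]; split=> /=.
    by case: lA => _ + _; exact.
  apply/adjointP => // s t Ast.
  move/adjointP: h2 => /(_ lA _ _ Ast) h2; move/adjointP: h4 => /(_ lA _ _ Ast) h4.
  by rewrite !rdotE h2 h4.
- move=> u Su cu; have [n|//|p Ap hp] := complete_graph cA (u := fst \o u).
    by case: (Su n).
  by exists (p, 0).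
- by move=> a p q /=; rewrite !rdotE; ring.
- exact: c0.
- move=> [[p1 p2] p3] [/= h1 h2].
  by have := h _ _ _ h1 h2; rewrite (adjoint_comp_rdot _ lA h2 h1).
suff -> : x = z by exists v.
apply/eqP; rewrite -subr_eq0; apply/eqP/rdot_eq0.
have [a [b [d [h1 h2 {1}<-]]]] := one_plus_adjoint_onto (x - z) lA cA.
have := hz (a, b, d) (conj h1 h2); rewrite /ip /graph_dot/= => h3.
by rewrite (siBr rdot_semi_inner) h3 (adjoint_comp_rdot _ lA h2 Az) subrr.
Qed.

Lemma dom_sub_of_adjoint_comp A T : linear_operator A -> closed_operator A ->
  linear_operator T -> closed_operator T ->
  op_comp (adjoint A) A = op_comp (adjoint T) T -> dom A `<=` dom T.
Proof.
move=> lA cA lT cT e x [y Axy].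
apply: (@dom_of_bound _ _ (rdot x x + rdot y y)) => //.
  by rewrite addr_ge0// rdot_ge0.
move=> u v w h1 h2.
have : op_comp (adjoint T) T (u, w) by exists v.
by rewrite -e => -[v' /= h3 h4]; exact: (dom_bound lA Axy h3 h4).
Qed.

End Operators.

(** * Reid's inequality *)

Section Reid.
Context {R : realType} {V : hilbertType R}.

Lemma bernoulli (t : R) n : 1 <= t -> 1 + n%:R * (t - 1) <= t ^+ n.
Proof.
move=> t1; elim: n => [|n ih]; first by rewrite mul0r addr0 expr0.
rewrite exprSr -natr1.
have t1' : 0 <= t - 1 by rewrite subr_ge0.
have : (1 + n%:R * (t - 1)) * t <= t ^+ n * t by rewrite ler_wpM2r//; lra.
have : 0 <= n%:R * (t - 1) * (t - 1) by rewrite !mulr_ge0.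
lra.
Qed.

(* Iterating Cauchy-Schwarz for the form <p2 x, y>, in which K is symmetric,
   gives (<p1 x, x> / <p2 x, x>)^(2^j) <= const * k^(2^j). *)
Lemma reid_inequality (p1 p2 K : {linear V -> V}) (c k : R) :
  (forall x y, rdot (p1 x) y = rdot x (p1 y)) ->
  (forall x y, rdot (p2 x) y = rdot x (p2 y)) ->
  (forall x, 0 <= rdot (p2 x) x) ->
  (forall x, nrm (p2 x) <= c * nrm x) ->
  (forall x, p1 x = p2 (K x)) ->
  0 < k -> (forall x, nrm (K x) <= k * nrm x) ->
  forall x, rdot (p1 x) x <= k * rdot (p2 x) x.
Proof.
move=> s1 s2 pos2 b2 fac k0 bK x.
pose ip a b := rdot (p2 a) b.
have ipP : semi_inner ip.
  split=> //; first by move=> z; exact: rdot_map_linear.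
  by move=> a b; rewrite /ip s2 rdotC.
have Ks a b : ip (K a) b = ip a (K b) by rewrite /ip -fac s1 fac s2.
have Kn n a b : ip (iter n K a) b = ip a (iter n K b).
  by elim: n a b => //= n ih a b; rewrite Ks ih -iterSr.
pose s n := ip (iter n K x) x; set q := ip x x.
rewrite fac -/(ip _ _) -/(ip x x) -/q.
have q0 : 0 <= q by exact: pos2.
have s_double n : s n ^+ 2 <= s (n + n)%N * q.
  by rewrite /s iterD (Kn n (iter n K x)); exact: si_cauchy_schwarz.
have [qz|qn0] := eqVneq q 0.
  have := si_cauchy_schwarz ipP (K x) x; rewrite -/q qz !mulr0 => h.
  have /eqP : ip (K x) x ^+ 2 == 0 by rewrite eq_le h sqr_ge0.
  by move=> /eqP; rewrite sqrf_eq0 => /eqP ->.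
have qp : 0 < q by rewrite lt_def qn0.
rewrite leNgt; apply/negP => hk.
(* [t] is the ratio of the two sides of the claim, supposed to exceed 1. Its powers of exponent
   [2 ^ j] will stay below [C], against Bernoulli's inequality. *)
pose t := ip (K x) x / (k * q).
have t1 : 1 < t by rewrite ltr_pdivlMr ?mulr_gt0// mul1r.
have tk0 : 0 <= t * k by apply: mulr_ge0; apply: ltW => //; exact: lt_trans t1.
have lower j : q * (t * k) ^+ (2 ^ j) <= s (2 ^ j)%N.
  elim: j => [|j ih].
    by rewrite expn0 expr1 /s/= /t le_eqVlt; apply/orP; left; apply/eqP; field;
      rewrite qn0 gt_eqF.
  rewrite expnSr muln2 -addnn exprD -(ler_pM2r qp); apply: le_trans (s_double _).
  have -> : q * ((t * k) ^+ (2 ^ j) * (t * k) ^+ (2 ^ j)) * q = (q * (t * k) ^+ (2 ^ j)) ^+ 2 by ring.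
  have h0 : 0 <= q * (t * k) ^+ (2 ^ j) by rewrite mulr_ge0// exprn_ge0.
  by rewrite ler_pXn2r ?nnegrE// (le_trans h0).
have nK n : nrm (iter n K x) <= k ^+ n * nrm x.
  elim: n => [|n ih] /=; first by rewrite expr0 mul1r.
  by apply: le_trans (bK _) _; rewrite exprS -mulrA ler_pM2l.
have upper n : s n <= `|c| * k ^+ n * nrm x ^+ 2.
  apply: le_trans (rdot_le _ _) _; rewrite expr2 mulrA ler_wpM2r ?nrm_ge0//.
  apply: le_trans (b2 _) _; rewrite -mulrA.
  apply: (@le_trans _ _ (`|c| * nrm (iter n K x))).
    by rewrite ler_wpM2r ?nrm_ge0// ler_norm.
  by rewrite ler_wpM2l.
pose C := `|c| * nrm x ^+ 2 / q.
have tC j : t ^+ (2 ^ j) <= C.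
  rewrite /C ler_pdivlMr//; have := le_trans (lower j) (upper _).
  rewrite exprMn mulrA (mulrC `|c|) -[leRHS]mulrA [leRHS]mulrC ler_pM2r ?exprn_gt0//.
  by rewrite mulrC.
have t0 : 0 < t - 1 by rewrite subr_gt0.
have [N tN CN] : exists2 N, t ^+ N <= C & C / (t - 1) < N%:R.
  exists (2 ^ (Num.truncn (C / (t - 1))).+1)%N; first exact: tC.
  apply: lt_le_trans (truncnS_gt _) _; rewrite ler_nat.
  exact/ltnW/ltn_expl.
have := le_trans (bernoulli N (ltW t1)) tN.
by move: CN; rewrite ltr_pdivrMr//; lra.
Qed.

End Reid.

(** * Square roots *)

Section PositiveContractions.
Context {R : realType} {V : hilbertType R}.
Implicit Types (x y z : V) (u v : nat -> V) (F J : {linear V -> V}).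

Lemma pack_linear (f : V -> V) : linear f ->
  exists g : {linear V -> V}, forall x, g x = f x.
Proof.
move=> lf; pose fM := GRing.isLinear.Build _ _ _ _ f lf.
by pose fL : {linear V -> V} := HB.pack f fM; exists fL.
Qed.

Lemma tends_unique u x y : tends_for nrm u x -> tends_for nrm u y -> x = y.
Proof.
move=> ux uy; apply: rdot_orth_eq => z; rewrite !(rdotC z).
exact: tends_rdot_eq ux uy _.
Qed.

Lemma tendsD u v x y : tends_for nrm u x -> tends_for nrm v y ->
  tends_for nrm (fun n => u n + v n) (x + y).
Proof.
move=> ux vy e e0.
have [|n hn] := ux (e / 2); first by rewrite divr_gt0.
have [|m hm] := vy (e / 2); first by rewrite divr_gt0.
exists (maxn n m) => k; rewrite geq_max => /andP[/hn h1 /hm h2].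
by rewrite opprD addrACA; have := nrmD (u k - x) (v k - y); lra.
Qed.

Lemma tends_map (f : V -> V) (c : R) u x :
  (forall a b, f (a - b) = f a - f b) ->
  (forall a, nrm (f a) <= c * nrm a) ->
  tends_for nrm u x -> tends_for nrm (f \o u) (f x).
Proof.
move=> fB fc ux e e0.
have c0 : 0 < `|c| + 1 by rewrite ltr_wpDl.
have [|n hn] := ux (e / (`|c| + 1)); first by rewrite divr_gt0.
exists n => k /hn h /=; rewrite -fB; apply: le_lt_trans (fc _) _.
apply: (@le_lt_trans _ _ ((`|c| + 1) * nrm (u k - x))).
  by apply: ler_wpM2r; [exact: nrm_ge0|have := ler_norm c; lra].
by rewrite mulrC -ltr_pdivlMr.
Qed.

Lemma nrm_scale (a : R[i]) x : nrm (a *: x) = complex.Re `|a| * nrm x.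
Proof.
have := normrZ a x; rewrite !normE => /(congr1 (@complex.Re _)) /= ->.
by case: `|a| => p q /=; rewrite mulr0 subr0.
Qed.

Lemma tendsZ (a : R[i]) u x : tends_for nrm u x ->
  tends_for nrm (fun n => a *: u n) (a *: x).
Proof.
apply: (@tends_map ( *:%R a) (complex.Re `|a|)) => [b d|b].
  by rewrite scalerBr.
by rewrite nrm_scale.
Qed.

Lemma tends_cst x : tends_for nrm (fun=> x) x.
Proof. by move=> e e0; exists 0%N => n _; rewrite subrr nrm0. Qed.

Lemma tends_nrm_le u x (c : R) : tends_for nrm u x ->
  (forall n, nrm (u n) <= c) -> nrm x <= c.
Proof.
move=> ux h; apply/ler_addgt0Pr => e /ux[n hn].
have := hn n (leqnn n); have := h n; have := nrmD (u n) (x - u n).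
by rewrite nrmB addrC subrK; lra.
Qed.

Definition symmetric_map (f : V -> V) := forall x y, rdot (f x) y = rdot x (f y).

Definition positive_contraction (f : V -> V) :=
  [/\ symmetric_map f, forall x, 0 <= rdot (f x) x
    & forall x, rdot (f x) x <= rdot x x].

(** Cauchy-Schwarz for the form of [J], at [x] and [J x], turns the bound on the quadratic form into
    a bound on the operator. *)
Lemma positive_contraction_nrm J x : positive_contraction J -> nrm (J x) <= nrm x.
Proof.
move=> [sJ pJ J1].
have ipP : semi_inner (fun a b => rdot (J a) b).
  split=> // [z|a b]; first exact: rdot_map_linear.
  by rewrite sJ rdotC.
have [J0|Jn0] := eqVneq (nrm (J x)) 0; first by rewrite J0 nrm_ge0.
have Jp : 0 < nrm (J x) by rewrite lt_def Jn0 nrm_ge0.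
rewrite -(@ler_pXn2r _ 2)// ?nnegrE ?nrm_ge0//.
have := si_cauchy_schwarz ipP x (J x); rewrite /= rdot_nrm => h.
have h1 : rdot (J x) x * rdot (J (J x)) (J x) <= nrm x ^+ 2 * nrm (J x) ^+ 2.
  by rewrite -!rdot_nrm ler_pM.
have := le_trans h h1; rewrite expr2 ler_pM2r// exprn_gt0//.
Qed.

Section SquareRoot.
Variables (J C : {linear V -> V}).
Hypothesis Jpc : positive_contraction J.
Hypothesis JC : forall x, C x = x - J x.

Let C_nrm x : nrm (C x) <= nrm x.
Proof.
case: Jpc => sJ pJ J1; apply: positive_contraction_nrm; split.
- by move=> a b; rewrite !JC !rdotE sJ.
- by move=> a; rewrite JC !rdotE subr_ge0.
- by move=> a; rewrite JC !rdotE gerBl.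
Qed.

Let C_sym : symmetric_map C.
Proof. by case: Jpc => sJ _ _ a b; rewrite !JC !rdotE sJ. Qed.

(* Polynomials in C with nonnegative coefficients and no constant term,
   together with their value at 1, which bounds their norm. *)
Inductive pos_poly : (V -> V) -> R -> Prop :=
| Pos_poly0 : pos_poly (fun=> 0) 0
| Pos_polyC : pos_poly C 1
| Pos_polyD f g a b : pos_poly f a -> pos_poly g b ->
    pos_poly (fun x => f x + g x) (a + b)
| Pos_polyM f g a b : pos_poly f a -> pos_poly g b ->
    pos_poly (fun x => f (g x)) (a * b)
| Pos_poly_half f a : pos_poly f a ->
    pos_poly (fun x => (2^-1 : R)%:C%C *: f x) (2^-1 * a).

Lemma pos_poly_linear f a : pos_poly f a -> linear f.
Proof.
elim=> {f a} [|k x y|f g a b _ lf _ lg|f g a b _ lf _ lg|f a _ lf] /=.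
- by move=> k x y; rewrite scaler0 addr0.
- by rewrite linearP.
- by move=> k x y /=; rewrite lf lg scalerDr addrACA.
- by move=> k x y /=; rewrite lg lf.
- by move=> k x y /=; rewrite lf scalerDr !scalerA mulrC.
Qed.

Lemma pos_poly_ge0 f a : pos_poly f a -> 0 <= a.
Proof.
by elim=> {f a} //= *; rewrite ?addr_ge0 ?mulr_ge0.
Qed.

Lemma pos_poly_nrm f a : pos_poly f a -> forall x, nrm (f x) <= a * nrm x.
Proof.
elim=> {f a} [||f g a b _ bf _ bg|f g a b pf bf _ bg|f a _ bf] x.
- by rewrite nrm0 mul0r.
- by rewrite mul1r; exact: C_nrm.
- by apply: le_trans (nrmD _ _) _; rewrite mulrDl lerD.
- apply: le_trans (bf _) _; rewrite -mulrA ler_wpM2l//; exact: pos_poly_ge0 pf.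
- by rewrite nrmZ gtr0_norm ?invr_gt0// -mulrA ler_wpM2l.
Qed.

Lemma pos_poly_comm F f a : (forall x, F (C x) = C (F x)) ->
  pos_poly f a -> forall x, F (f x) = f (F x).
Proof.
move=> FC; elim=> {f a} [||f g a b _ hf _ hg|f g a b _ hf _ hg|f a _ hf] x /=.
- by rewrite linear0.
- by rewrite FC.
- by rewrite linearD hf hg.
- by rewrite hf hg.
- by rewrite linearZ/= hf.
Qed.

Lemma pos_poly_comm2 f g a b : pos_poly f a -> pos_poly g b ->
  forall x, f (g x) = g (f x).
Proof.
move=> pf pg x; have [F hF] := pack_linear (pos_poly_linear pf).
rewrite -!hF; apply: (pos_poly_comm _ pg) => y.
by rewrite !hF -(pos_poly_comm (F := C) _ pf).
Qed.

Lemma pos_poly_sym f a : pos_poly f a -> symmetric_map f.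
Proof.
elim=> {f a} [||f g a b _ sf _ sg|f g a b pf sf pg sg|f a _ sf] x y /=.
- by rewrite rdot0x rdotx0.
- exact: C_sym.
- by rewrite !rdotE sf sg.
- by rewrite sf sg (pos_poly_comm2 pf pg).
- by rewrite !rdotE sf.
Qed.

(** A fixed point [W] of the iteration satisfies [2 W = C + W^2], that is [(1 - W)^2 = 1 - C = J];
    the root of [J] will be [1 - W]. *)
Fixpoint root_iter n : V -> V :=
  if n is m.+1 then
    fun x => (2^-1 : R)%:C%C *: (C x + root_iter m (root_iter m x))
  else fun=> 0.

Fixpoint root_bound n : R :=
  if n is m.+1 then 2^-1 * (1 + root_bound m * root_bound m) else 0.

Lemma pos_poly_iter n : pos_poly (root_iter n) (root_bound n).
Proof.
elim: n => [|n ih] /=; first exact: Pos_poly0.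
by apply: Pos_poly_half (Pos_polyD Pos_polyC _); exact: Pos_polyM.
Qed.

(** Polynomials in [C] commute, so a difference of squares factors and the coefficients of
    successive differences remain nonnegative. Convergence of the operators thus reduces to that of
    the bounded monotone sequence [root_bound]. *)
Lemma pos_poly_diff n :
  pos_poly (fun x => root_iter n.+1 x - root_iter n x)
    (root_bound n.+1 - root_bound n).
Proof.
elim: n => [|n ih].
  rewrite /= mulr0 addr0 subr0.
  have -> : (fun x => (2^-1 : R)%:C%C *: (C x + 0) - 0) =
            (fun x => (2^-1 : R)%:C%C *: C x).
    by apply/funext => x; rewrite addr0 subr0.
  exact: Pos_poly_half Pos_polyC.
have pn := pos_poly_iter n; have pS := pos_poly_iter n.+1.
have {ih} := Pos_poly_half (Pos_polyM ih (Pos_polyD pS pn)).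
set f := fun x => _; set a := 2^-1 * _.
set g := fun x => _; set b := root_bound n.+2 - _.
suff -> : f = g by suff -> : a = b by []; rewrite /a /b /=; field.
apply/funext => x; rewrite /f /g.
have lS := pos_poly_linear pS; have ln := pos_poly_linear pn.
have lSD y z : root_iter n.+1 (y + z) = root_iter n.+1 y + root_iter n.+1 z.
  by have := lS 1 y z; rewrite !scale1r.
have lnD y z : root_iter n (y + z) = root_iter n y + root_iter n z.
  by have := ln 1 y z; rewrite !scale1r.
have e m y : root_iter m.+1 y =
  (2^-1 : R)%:C%C *: (C y + root_iter m (root_iter m y)) by [].
rewrite [root_iter n.+2 x]e [in X in _ - X]e -scalerBr lSD lnD.
rewrite (pos_poly_comm2 pn pS); congr (_ *: _).
by rewrite addrKA [C x + _]addrC addrKA.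
Qed.

Lemma root_bound_le1 n : root_bound n <= 1.
Proof.
elim: n => //= n ih; have b0 := pos_poly_ge0 (pos_poly_iter n).
have : root_bound n * root_bound n <= 1 * 1 by rewrite ler_pM.
lra.
Qed.

Lemma root_iter_diff n k x :
  nrm (root_iter (n + k) x - root_iter n x) <=
  (root_bound (n + k) - root_bound n) * nrm x.
Proof.
elim: k => [|k ih]; first by rewrite addn0 !subrr nrm0 mul0r.
have := pos_poly_nrm (pos_poly_diff (n + k)) x; rewrite addnS.
have := nrmD (root_iter (n + k).+1 x - root_iter (n + k) x)
  (root_iter (n + k) x - root_iter n x).
by rewrite addrA subrK; lra.
Qed.

Lemma root_bound_cauchy (e : R) : 0 < e -> exists n, forall k,
  root_bound (n + k) - root_bound n < e.
Proof.
move=> e0; have hs : has_sup (range root_bound).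
  by split; [exists 0, 0%N|exists 1 => _ [n _ <-]; exact: root_bound_le1].
have [_ [n _ <-] hn] := sup_adherent e0 hs.
exists n => k; have : root_bound (n + k) <= sup (range root_bound).
  by apply: sup_ubound; [case: hs|exists (n + k)%N].
lra.
Qed.

Lemma root_iter_lim : exists w : V -> V, forall x,
  tends_for nrm (root_iter ^~ x) (w x).
Proof.
suff /choice[w hw] : forall x, exists y, tends_for nrm (root_iter ^~ x) y by exists w.
move=> x; apply: hilbert_complete => e e0.
pose k := 2 * (nrm x + 1).
have k0 : 0 < k by rewrite mulr_gt0// ltr_wpDl// nrm_ge0.
have [|n hn] := @root_bound_cauchy (e / k); first by rewrite divr_gt0.
have half p : (n <= p)%N -> nrm (root_iter p x - root_iter n x) < e / 2.
  move=> np; have := root_iter_diff n (p - n) x; have := hn (p - n)%N.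
  rewrite subnKC// => h1 h2; apply: le_lt_trans h2 _.
  apply: (@le_lt_trans _ _ (e / k * nrm x)).
    by rewrite ler_wpM2r ?nrm_ge0// ltW.
  have -> : e / 2 = e / k * (nrm x + 1) by rewrite /k; field;
    rewrite gt_eqF// ltr_wpDl// nrm_ge0.
  by rewrite ltr_pM2l ?divr_gt0// ltrDl.
exists n => p q /half hp /half hq.
have := nrmD (root_iter p x - root_iter n x) (root_iter n x - root_iter q x).
by rewrite addrA subrK (nrmB (root_iter n x)); lra.
Qed.

Lemma positive_contraction_root_aux : exists c : {linear V -> V},
  [/\ positive_contraction c, forall x, c (c x) = J x
    & forall F, (exists k : R, forall x, nrm (F x) <= k * nrm x) ->
        (forall x, F (J x) = J (F x)) -> forall x, F (c x) = c (F x)].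
Proof.
have [w hw] := root_iter_lim.
have lw : linear w.
  move=> a x y; apply: tends_unique (hw _) _.
  have := tendsD (tendsZ a (hw x)) (hw y); congr tends_for.
  by apply/funext => n; rewrite (pos_poly_linear (pos_poly_iter n)).
have [W eW] := pack_linear lw.
have {}hw x : tends_for nrm (root_iter ^~ x) (W x) by rewrite eW.
have Yn n x : nrm (root_iter n x) <= nrm x.
  apply: le_trans (pos_poly_nrm (pos_poly_iter n) x) _.
  by rewrite ler_piMl ?nrm_ge0// root_bound_le1.
have Wn x : nrm (W x) <= nrm x by apply: tends_nrm_le (hw x) _.
have sW : symmetric_map W.
  move=> x y; rewrite (rdotC x); apply: tends_rdot_eq (hw x) (hw y) _ => n.
  by rewrite (pos_poly_sym (pos_poly_iter n)) rdotC.
(* Split the inner iterate as [(root_iter n x - W x) + W x]: the outer iterates are contractions, so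
   the first part tends to 0. *)
have YW x : tends_for nrm (fun n => root_iter n (root_iter n x)) (W (W x)).
  have h1 : tends_for nrm (fun n => root_iter n (root_iter n x - W x)) 0.
    move=> e /(hw x)[n hn]; exists n => m /hn h.
    by rewrite subr0; exact: le_lt_trans (Yn _ _) h.
  have := tendsD h1 (hw (W x)); rewrite add0r; congr tends_for.
  apply/funext => n; have := pos_poly_linear (pos_poly_iter n) 1 (root_iter n x - W x) (W x).
  by rewrite !scale1r subrK.
have fix_W x : W x = (2^-1 : R)%:C%C *: (C x + W (W x)).
  have h1 := tendsZ (2^-1 : R)%:C%C (tendsD (tends_cst (C x)) (YW x)).
  apply: tends_unique (h1) => e /(hw x)[n hn]; exists n => m nm.
  exact: (hn m.+1 (leqW nm)).
have WW x : W (W x) = W x + W x - C x.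
  apply: rdot_orth_eq => z; have := congr1 (rdot z) (fix_W x).
  by rewrite !rdotE; lra.
have [c hc] : exists c : {linear V -> V}, forall x, c x = x - W x.
  apply: pack_linear => a x y /=.
  by rewrite linearP scalerBr opprD addrACA.
have cc x : c (c x) = J x.
  rewrite !hc linearB/= WW JC.
  by apply: rdot_orth_eq => z; rewrite !rdotE; ring.
have sc : symmetric_map c by move=> x y; rewrite !hc !rdotE sW.
exists c; split=> //.
- split=> // x.
    rewrite hc !rdotE subr_ge0; apply: le_trans (rdot_le _ _) _.
    by rewrite rdot_nrm expr2 ler_wpM2r ?nrm_ge0.
  apply: le_trans (rdot_le _ _) _; rewrite rdot_nrm expr2 ler_wpM2r ?nrm_ge0//.
  rewrite -(@ler_pXn2r _ 2)// ?nnegrE ?nrm_ge0// -!rdot_nrm sc cc.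
  by case: Jpc => _ _ h; rewrite rdotC.
- move=> F [k hk] FJ x; rewrite !hc linearB/=; congr (_ - _).
  have FC y : F (C y) = C (F y) by rewrite !JC linearB/= FJ.
  have h1 := tends_map (linearB F) hk (hw x).
  apply: tends_unique h1 _; have := hw (F x); congr tends_for.
  by apply/funext => n; rewrite /= (pos_poly_comm FC (pos_poly_iter n)).
Qed.

End SquareRoot.
End PositiveContractions.

Section SquareRoots.
Context {R : realType} {V : hilbertType R}.
Implicit Types (x y z : V) (F J : {linear V -> V}) (L M S : operator V).

(** The last clause, inherited from the approximating polynomials, is what makes the roots of
    different functions of one resolvent commute. *)
Lemma positive_contraction_root J : positive_contraction J ->
  exists c : {linear V -> V},
  [/\ positive_contraction c, forall x, c (c x) = J x
    & forall F, (exists k : R, forall x, nrm (F x) <= k * nrm x) ->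
        (forall x, F (J x) = J (F x)) -> forall x, F (c x) = c (F x)].
Proof.
move=> pJ; have [C JC] : exists C : {linear V -> V}, forall x, C x = x - J x.
  apply: pack_linear => a x y /=.
  by rewrite linearP scalerBr opprD addrACA.
exact: positive_contraction_root_aux pJ JC.
Qed.

Lemma self_adjoint_resolvent L : self_adjoint L -> op_positive L ->
  exists J : {linear V -> V}, [/\ positive_contraction J,
    forall z, L (J z, z - J z) & forall x y, L (x, y) -> J (x + y) = x].
Proof.
move=> sL pL; have lL : linear_operator L by case: sL.
have [||J hJ] := @linear_of_graph _ V [set p | L (p.2, p.1 - p.2)].
- split=> /=; first by rewrite subr0; case: lL.
    move=> a x x' y y' h h'; case: lL => _ /(_ a _ _ _ _ h h') + _.
    by rewrite scalerBr opprD addrACA.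
  move=> y h; have := op_positive_rdot pL h.
  rewrite !rdotE rdot0x => h1; apply: rdot_eq0; have := rdot_ge0 y; lra.
- apply/seteqP; split=> // z _.
  have [u [w [h <-]]] := one_plus_self_adjoint_onto z sL pL.
  by exists u => /=; rewrite addrC addKr.
have JL z : L (J z, z - J z) by have [_ /(_ erefl)] := hJ z (J z).
have LJ x y : L (x, y) -> J (x + y) = x.
  by move=> h; apply/esym/hJ => /=; rewrite addrC addKr.
exists J; split=> //; split=> [x y|x|x].
- have := self_adjoint_sym sL (JL x) (JL y); rewrite !rdotE => /eqP.
  by rewrite subr_eq subrK => /eqP ->.
- have := op_positive_rdot pL (JL x); rewrite !rdotE (rdotC x).
  have := rdot_ge0 (J x); lra.
- have := op_positive_rdot pL (JL x); have := rdot_ge0 (x - J x).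
  rewrite !rdotE (rdotC x (J x)); lra.
Qed.

(* With J = (1 + L)^-1, c = J^(1/2) and e = (1 - J)^(1/2), the root of L is
   e c^-1; everything follows from c^2 + e^2 = 1 and c e = e c. *)
Lemma op_sqrt_exists L : self_adjoint L -> op_positive L ->
  exists S, [/\ self_adjoint S, op_positive S & op_comp S S = L].
Proof.
move=> sL pL; have lL : linear_operator L by case: sL.
have [J [pJ JL LJ]] := self_adjoint_resolvent sL pL.
have [C JC] : exists C : {linear V -> V}, forall x, C x = x - J x.
  apply: pack_linear => a x y /=.
  by rewrite linearP scalerBr opprD addrACA.
have pC : positive_contraction C.
  case: (pJ) => sJ pJ' J1; split.
  - by move=> a b; rewrite !JC !rdotE sJ.
  - by move=> a; rewrite JC !rdotE subr_ge0.
  - by move=> a; rewrite JC !rdotE gerBl.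
have [c [pc cc cF]] := positive_contraction_root pJ.
have [e [pe ee eF]] := positive_contraction_root pC.
(* [d] is a fourth root of [J]; it gives the positivity of [S], as [<e w, c w> = <e d w, d w>]. *)
have [d [pd dd dF]] := positive_contraction_root pc.
have bnd (f : {linear V -> V}) : positive_contraction f ->
    exists k : R, forall x, nrm (f x) <= k * nrm x.
  by move=> pf; exists 1 => x; rewrite mul1r; exact: positive_contraction_nrm.
have ce x : c (e x) = e (c x).
  by apply: eF (bnd _ pc) _ _ => y; rewrite !JC linearB/= -!cc.
have de x : d (e x) = e (d x).
  by apply: eF (bnd _ pd) _ _ => y; rewrite !JC linearB/= -!cc -!dd.
have [sc _ _] := pc; have [se e_ge0 _] := pe; have [sd _ _] := pd.
have unit x : c (c x) + e (e x) = x by rewrite cc ee JC addrC subrK.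
pose S : operator V := [set p | exists w, p.1 = c w /\ p.2 = e w].
have lS : linear_operator S.
  split; first by exists 0; rewrite !linear0.
    move=> a x x' y y' [u /= [-> ->]] [v /= [-> ->]]; exists (a *: u + v).
    by rewrite /= !linearP.
  move=> y [w /= [cw ->]]; have Jw : J w = 0 by rewrite -cc -cw linear0.
  have := JL w; rewrite Jw subr0; case: lL => _ _ h /h ->; exact: linear0.
have sS x y z w : S (x, y) -> S (z, w) -> rdot y z = rdot x w.
  by move=> [a /= [-> ->]] [b /= [-> ->]]; rewrite se sc ce.
have pS x y : S (x, y) -> 0 <= rdot y x.
  by move=> [a /= [-> ->]]; rewrite -dd -sd de; exact: e_ge0.
exists S; split; last 2 first.
- exact: op_positive_of_sym.
- apply/seteqP; split=> [[x z] [y /= [w /= [-> ->]] [v /= [ewcv ->]]]|[x y] Lxy].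
    have xJ : c w = J (c w + e v).
      by rewrite -cc linearD/= ce -ewcv unit.
    suff -> : e v = c w + e v - J (c w + e v) by rewrite {1}xJ; exact: JL.
    by rewrite -xJ addrC addKr.
  exists (e (c (x + y))).
    by exists (c (x + y)) => /=; rewrite cc LJ.
  exists (e (x + y)) => /=; split; first by rewrite ce.
  by rewrite ee JC LJ// addrC addKr.
split=> //.
  apply/denseP => x r r0; case: sL => _ /denseP dL _.
  have [s [y Lsy] hs] := dL x r r0; exists s => //.
  by exists (e (c (s + y))), (c (s + y)) => /=; rewrite cc LJ.
apply/seteqP; split=> [[x y] Sxy|[y y'] /adjointP h].
  by apply/adjointP => // z w Szw; exact: sS Szw Sxy.
(* Membership of [(y, y')] in the adjoint means [e y = c y']; since [c^2 + e^2 = 1], the parameter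
   of this point of [S] is [c y + e y']. *)
have ey : e y = c y'.
  apply: rdot_orth_eq => z; rewrite -se -sc; apply: (h lS).
  by exists z.
exists (c y + e y') => /=; rewrite !linearD; split.
  by rewrite ce -ey unit.
by rewrite -[e (c y)]ce ey unit.
Qed.

Lemma op_sqrt_spec L : self_adjoint L -> op_positive L ->
  [/\ self_adjoint (op_sqrt L), op_positive (op_sqrt L)
    & op_comp (op_sqrt L) (op_sqrt L) = L].
Proof.
move=> sL pL; rewrite /op_sqrt; case: xgetP => [S _ //|noS].
by have [S hS] := op_sqrt_exists sL pL; case: (noS S).
Qed.

(** The default value of [op_sqrt] is the empty graph, so a single point certifies a genuine root.
    For [|T + B|] the polar decomposition supplies such a point. *)
Lemma op_sqrt_neq0 L : op_sqrt L !=set0 ->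
  [/\ self_adjoint (op_sqrt L), op_positive (op_sqrt L)
    & op_comp (op_sqrt L) (op_sqrt L) = L].
Proof.
rewrite /op_sqrt; case: xgetP => [S _ //|_ [x []]].
Qed.

(** The domains agree because [T] and [|T|] are closed operators with the same product [A^* A]. *)
Lemma op_abs_spec T : linear_operator T -> dense (dom T) -> closed_operator T ->
  [/\ self_adjoint (op_abs T), op_positive (op_abs T) & dom (op_abs T) = @dom R V T].
Proof.
move=> lT dT cT; have [sL pL] := adjoint_comp_self_adjoint lT dT cT.
have [sM pM MM] := op_sqrt_spec sL pL; split=> //.
have [lM _ eM] := sM; have cM := self_adjoint_closed sM.
have e : op_comp (adjoint (op_abs T)) (op_abs T) = op_comp (adjoint T) T.
  by rewrite -MM -eM.
by apply/seteqP; split; apply: dom_sub_of_adjoint_comp.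
Qed.

(* S is M^(1/2) and J is (1 + M)^-1. *)
Lemma dom_root_bound S M J x : self_adjoint S -> op_comp S S = M ->
  (forall z, M (J z, z - J z)) -> (forall u w, M (u, w) -> J (u + w) = u) ->
  dom S x <-> exists2 c : R, 0 <= c & forall z, rdot z x ^+ 2 <= c * rdot z (J z).
Proof.
move=> sS SS MJ JM; have [lS _ eS] := sS; have cS := self_adjoint_closed sS.
split=> [[y Sxy]|[c c0 h]].
  exists (rdot x x + rdot y y) => [|z]; first by rewrite addr_ge0// rdot_ge0.
  have := MJ z; rewrite -SS => -[v /= h1 h2].
  rewrite eS in h2; have := dom_bound lS Sxy h1 h2.
  by rewrite addrC subrK.
apply: (dom_of_bound lS cS c0) => u v w h1; rewrite -eS => h2.
have Muw : M (u, w) by rewrite -SS; exists v.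
by have := h (u + w); rewrite (JM _ _ Muw).
Qed.

End SquareRoots.

(** * Comparison of ranges and domains *)

Section Domination.
Context {R : realType} {V : hilbertType R}.
Implicit Types (x y z : V) (f g h : V -> R) (G : {linear V -> V}).

Definition dominated f g := exists2 c : R, 0 <= c & forall x, f x <= c * g x.

Lemma dominated_trans g f h : dominated f g -> dominated g h -> dominated f h.
Proof.
move=> [c c0 fg] [d d0 gh]; exists (c * d) => [|x]; first exact: mulr_ge0.
by apply: le_trans (fg x) _; rewrite -mulrA ler_wpM2l.
Qed.

Lemma dominated_sqr f g : (forall x, 0 <= f x) -> (forall x, 0 <= g x) ->
  dominated f g -> dominated (fun x => f x ^+ 2) (fun x => g x ^+ 2).
Proof.
move=> f0 g0 [c c0 h]; exists (c ^+ 2) => [|x]; first exact: sqr_ge0.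
by rewrite -exprMn ler_pXn2r ?nnegrE// mulr_ge0.
Qed.

Lemma dominated_of_sqr f g : (forall x, 0 <= f x) -> (forall x, 0 <= g x) ->
  dominated (fun x => f x ^+ 2) (fun x => g x ^+ 2) -> dominated f g.
Proof.
move=> f0 g0 [c c0 h]; exists (Num.sqrt c) => [|x]; first exact: sqrtr_ge0.
rewrite -(@ler_pXn2r _ 2) ?nnegrE// ?mulr_ge0 ?sqrtr_ge0//.
by rewrite exprMn sqr_sqrtr.
Qed.

(** Douglas' lemma for one vector: the bound makes [G z |-> <z, x>] a bounded functional,
    represented by some [k], so that [x = G k]. Working on pairs [(z, G z)] with a form that sees
    only [G z] avoids choosing preimages. *)
Lemma range_bound G x : symmetric_map G ->
  range G x <-> exists2 c : R, 0 <= c & forall z, rdot z x ^+ 2 <= c * nrm (G z) ^+ 2.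
Proof.
move=> sG; split=> [[k _ <-]|[c c0 h]].
  exists (nrm k ^+ 2) => [|z]; first exact: sqr_ge0.
  by rewrite -sG mulrC -!rdot_nrm; exact: si_cauchy_schwarz rdot_semi_inner _ _.
pose ip (p q : V * V) := rdot p.2 q.2.
have ipP : semi_inner ip.
  split=> [p a q r|p q|p]; rewrite /ip/=.
  - exact: rdot_linear.
  - exact: rdotC.
  - exact: rdot_ge0.
have [|||||[z k] [_ /= hz _]] := @riesz _ _ _ ipP [set p | p.2 = G p.1] setT
  (fun p => rdot p.1 x) c.
- split=> /=; first by rewrite linear0.
  by move=> a [p q] [r s] /= -> ->; rewrite linearP.
- move=> u _ cu; have [y hy] := @hilbert_complete _ V (snd \o u) cu.
  by exists (0, y) => // e /hy[n hn]; exists n.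
- by move=> a p q; exact: rdot_linear.
- exact: c0.
- by move=> [p q] /= ->; rewrite /ip rdot_nrm.
exists k => //; apply: rdot_orth_eq => y.
by rewrite -sG; apply/esym/(hz (y, G y)).
Qed.

Lemma symmetric_bounded (K : {linear V -> V}) : symmetric_map K ->
  exists2 c : R, 0 <= c & forall x, nrm (K x) <= c * nrm x.
Proof.
move=> sK; apply: (@formal_adjoint_bounded _ _ _ setT) => [|z _].
  by apply/denseP => x e e0; exists x => //; rewrite subrr nrm0.
by exists (K z) => x; exact: sK.
Qed.

(** [K = p2^-1 p1] is everywhere defined, and [<K x, p2 z> = <x, p1 z>] gives it a formal adjoint on
    a dense set. Hellinger-Toeplitz bounds [K], and Reid's inequality applies. *)
Lemma dominated_of_range (p1 p2 : {linear V -> V}) :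
  symmetric_map p1 -> symmetric_map p2 -> (forall x, 0 <= rdot (p2 x) x) ->
  (forall x, p2 x = 0 -> x = 0) -> dense (range p2) -> range p1 `<=` range p2 ->
  dominated (fun x => rdot (p1 x) x) (fun x => rdot (p2 x) x).
Proof.
move=> s1 s2 pos2 i2 d2 r12.
have /choice[f hf] : forall x, exists y, p1 x = p2 y.
  by move=> x; have [|y _ <-] := r12 (p1 x); [exists x|exists y].
have [K fK] : exists K : {linear V -> V}, forall x, K x = f x.
  apply: pack_linear => a x y; apply/eqP; rewrite -subr_eq0; apply/eqP/i2.
  by rewrite linearB -hf (linearP p1) (linearP p2) !hf subrr.
have fac x : p1 x = p2 (K x) by rewrite fK.
have [c _ hc] := symmetric_bounded s2.
have [k k0 hk] : dominated (fun x => nrm (K x)) nrm.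
  apply: (formal_adjoint_bounded d2) => _ [z _ <-].
  by exists (p1 z) => x; rewrite -s2 -fac s1.
exists (k + 1); first by rewrite addr_ge0.
apply: (reid_inequality s1 s2 pos2 hc fac) => [|x].
  by rewrite ltr_wpDl.
apply: le_trans (hk x) _; apply: ler_wpM2r; first exact: nrm_ge0.
by rewrite lerDl.
Qed.

(** From dominations to equality, [dom_root_bound] and [range_bound] are compared. Conversely,
    uniform boundedness is used twice: on [V] for one domination, on the graph of [S] for the
    other. *)
Lemma dom_root_eq_range (S M : operator V) (J G : {linear V -> V}) :
  self_adjoint S -> op_comp S S = M -> symmetric_map G ->
  (forall z, M (J z, z - J z)) -> (forall u w, M (u, w) -> J (u + w) = u) ->
  dom S = range G <->
  dominated (fun z => nrm (G z) ^+ 2) (fun z => rdot z (J z)) /\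
  dominated (fun z => rdot z (J z)) (fun z => nrm (G z) ^+ 2).
Proof.
move=> sS SS sG MJ JM; have [lS _ eS] := sS.
have domS x := dom_root_bound x sS SS MJ JM.
split=> [SG|[[c c0 hc] [d d0 hd]]]; last first.
  apply/seteqP; split=> x.
    move=> /domS[k k0 hk]; apply/(range_bound _ sG).
    exists (k * d) => [|z]; first exact: mulr_ge0.
    by apply: le_trans (hk z) _; rewrite -mulrA ler_wpM2l.
  move=> /(range_bound _ sG)[k k0 hk]; apply/domS.
  exists (k * c) => [|z]; first exact: mulr_ge0.
  by apply: le_trans (hk z) _; rewrite -mulrA ler_wpM2l.
(* [v z] is [S (J z)]. In the graph inner product of [S], the functional [x |-> <x, z>] is
   represented by [(J z, v z)], whose squared norm is [<z, J z>]. *)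
have /choice[v hv] : forall z, exists v, S (J z, v) /\ S (v, z - J z).
  by move=> z; have := MJ z; rewrite -SS => -[v /= h1 h2]; exists v.
have form z x y : S (x, y) -> rdot x (J z) + rdot y (v z) = rdot x z.
  move=> Sxy; have [_ h2] := hv z; rewrite eS in h2.
  have := adjoint_comp_rdot (J z) lS h2 Sxy; rewrite [J z + _]addrC subrK => e.
  by rewrite rdotC (rdotC y) -e rdotC.
have Jz z : rdot z (J z) = graph_dot (J z, v z) (J z, v z).
  by rewrite /graph_dot/= (form z _ _ (hv z).1) rdotC.
have Jz0 z : 0 <= rdot z (J z) by rewrite Jz; exact: si_ge0 graph_dot_semi_inner _.
split.
  suff [c c0 hc] : dominated (fun z => nrm (G z)) (fun z => Num.sqrt (rdot z (J z))).
    have [k k0 hk] := dominated_sqr (fun z => nrm_ge0 (G z))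
      (fun z => sqrtr_ge0 (rdot z (J z))) (ex_intro2 _ _ c c0 hc).
    by exists k => // x; have := hk x; rewrite (sqr_sqrtr (Jz0 x)).
  apply: weakly_bounded_family => [z|y]; first exact: sqrtr_ge0.
  have /domS[c c0 hc] : dom S (G y) by rewrite SG; exists y.
  exists (Num.sqrt c) => z; rewrite sG -sqrtrM// -sqrtr_sqr ler_sqrt//.
  by rewrite mulr_ge0.
have [|||||c c0 hc] := @uniform_boundedness R _ S
  (fun p => Num.sqrt (graph_dot p p)) (real_subspace_operator lS) _
  (complete_graph (self_adjoint_closed sS)) V
  (fun z p => graph_dot p (J z, v z)) (fun z => nrm (G z)).
- split=> *; first exact: sqrtr_ge0.
    exact: si_triangle graph_dot_semi_inner _ _.
  exact: si_sqrtZ graph_dot_semi_inner _ _.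
- by move=> z; exact: nrm_ge0.
- by move=> z; case: (@graph_dot_semi_inner R V) => h _ _; exact: h.
- move=> z; exists (Num.sqrt (graph_dot (J z, v z) (J z, v z))) => p _.
  by rewrite mulrC; exact: si_cauchy_schwarz_sqrt graph_dot_semi_inner _ _.
- move=> [x y] Sxy; have [k _ kx] : range G x by rewrite -SG; exists y.
  exists (nrm k) => z; rewrite /graph_dot/= form// -kx sG.
  exact: nrm_dot.
exists (c ^+ 2) => [|z]; first exact: sqr_ge0.
have := hc z (J z, v z) (hv z).1; rewrite -Jz ger0_norm// -exprMn.
set s := rdot z (J z); set b := c * _ => h.
have b0 : 0 <= b by rewrite mulr_ge0// nrm_ge0.
have [s0|sn0] := eqVneq (Num.sqrt s) 0.
  by move: h; rewrite s0 mulr0 => h; apply: le_trans h (sqr_ge0 _).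
have sp : 0 < Num.sqrt s by rewrite lt_def sn0 sqrtr_ge0.
rewrite -[s]sqr_sqrtr ?Jz0// ler_pXn2r// ?nnegrE ?sqrtr_ge0//.
by rewrite -(ler_pM2r sp) -expr2 sqr_sqrtr ?Jz0.
Qed.

Section Factorization.
Variables (G p h : {linear V -> V}).
Hypotheses (sG : symmetric_map G) (dG : dense (range G)).
Hypotheses (sp : symmetric_map p) (pos_p : forall x, 0 <= rdot (p x) x).
Hypothesis (ph : forall x, p x = G (h x)).

Let pE z y : rdot (p z) y = rdot (h z) (G y).
Proof. by rewrite ph sG. Qed.

(** [<h z, G w> = <p z, w>] is at most the square root of [<p z, z> <p w, w>], hence of
    [c <p z, z> |G w|^2]; as [G] has dense range, this bounds [|h z|]. *)
Let sqr_bound (q : V -> R) :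
  dominated (fun z => rdot (p z) z) (fun z => nrm (G z) ^+ 2) ->
  dominated (fun z => nrm (h z) ^+ 2) (fun z => rdot (p z) z).
Proof.
have ipP : semi_inner (fun a b => rdot (p a) b).
  split=> // [z|a b]; first exact: rdot_map_linear.
  by rewrite sp rdotC.
move=> [c c0 hc]; exists c => // z.
have s0 := pos_p z; have sc : 0 <= c * rdot (p z) z by rewrite mulr_ge0.
rewrite -[leRHS]sqr_sqrtr// ler_pXn2r// ?nnegrE ?nrm_ge0 ?sqrtr_ge0//.
apply: (dense_dual_norm dG); first exact: sqrtr_ge0.
move=> _ [w _ <-]; rewrite -pE; apply: le_trans (ler_norm _) _.
rewrite -(@ler_pXn2r _ 2) ?nnegrE// ?mulr_ge0 ?sqrtr_ge0 ?nrm_ge0//.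
rewrite exprMn sqr_sqrtr// real_normK ?num_real//.
apply: le_trans (si_cauchy_schwarz ipP _ _) _.
by rewrite (mulrC c) -mulrA ler_wpM2l.
Qed.

Lemma dominated_factor :
  (dominated (fun z => nrm (h z)) (fun z => nrm (G z)) /\
   dominated (fun z => nrm (G z)) (fun z => nrm (h z))) <->
  (dominated (fun z => rdot (p z) z) (fun z => nrm (G z) ^+ 2) /\
   dominated (fun z => nrm (G z) ^+ 2) (fun z => rdot (p z) z)).
Proof.
have n0 (k : {linear V -> V}) x : 0 <= nrm (k x) by exact: nrm_ge0.
split=> [[[c c0 hc] h2]|[h1 [c c0 hc]]].
  have h1 : dominated (fun z => rdot (p z) z) (fun z => nrm (G z) ^+ 2).
    exists c => // z; rewrite pE; apply: le_trans (rdot_le _ _) _.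
    by rewrite expr2 mulrA ler_wpM2r.
  split=> //; apply: dominated_trans (dominated_sqr _ _ h2) (sqr_bound _ h1) => //.
split.
  apply: dominated_of_sqr => //.
  exact: dominated_trans (sqr_bound _ h1) h1.
exists c => // z; have [->|Gn0] := eqVneq (nrm (G z)) 0; first by rewrite mulr_ge0.
have Gp : 0 < nrm (G z) by rewrite lt_def Gn0 n0.
rewrite -(ler_pM2r Gp) -expr2; apply: le_trans (hc z) _.
by rewrite -mulrA ler_wpM2l// pE; exact: rdot_le.
Qed.

End Factorization.

(** Substituting [U z] for [z] in [range_bound], [U x] lies in the range of [G] exactly when
    [<z, x>^2] is bounded by a multiple of [|G (U z)|^2]. *)
Lemma image_range_eq_iff G (U Ui : {linear V -> V}) : symmetric_map G ->
  (forall x y, rdot (U x) y = rdot x (Ui y)) ->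
  (forall x, U (Ui x) = x) -> (forall x, Ui (U x) = x) ->
  U @` range G = range G <->
  dominated (fun z => nrm (G (U z))) (fun z => nrm (G z)) /\
  dominated (fun z => nrm (G z)) (fun z => nrm (G (U z))).
Proof.
move=> sG adj UK KU; split=> [e|[[c c0 hc] [d d0 hd]]].
  split; apply: weakly_bounded_family => [z|y]; try exact: nrm_ge0.
    have : range G (G y) by exists y.
    rewrite -{1}e => -[_ [k _ <-] Uk]; exists (nrm k) => z.
    by rewrite sG -Uk adj KU -sG mulrC; exact: nrm_dot.
  have : range G (U (G y)) by rewrite -e; exists (G y) => //; exists y.
  move=> [k _ Gk]; exists (nrm k) => z.
  have -> : rdot (G z) y = rdot (G (U z)) k by rewrite !sG Gk adj KU.
  by rewrite mulrC; exact: nrm_dot.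
have iff1 x : range G (U x) <->
    exists2 c : R, 0 <= c & forall z, rdot z x ^+ 2 <= c * nrm (G (U z)) ^+ 2.
  split=> [/(range_bound _ sG)|] [k k0 hk]; last apply/(range_bound _ sG).
    by exists k => // z; have := hk (U z); rewrite adj KU.
  by exists k => // z; have := hk (Ui z); rewrite UK -(UK z) adj !KU UK.
have G2 := dominated_sqr (fun z => nrm_ge0 (G (U z))) (fun z => nrm_ge0 (G z))
  (ex_intro2 _ _ c c0 hc).
have U2 := dominated_sqr (fun z => nrm_ge0 (G z)) (fun z => nrm_ge0 (G (U z)))
  (ex_intro2 _ _ d d0 hd).
have iff2 x : range G (U x) <-> range G x.
  split.
    move=> /iff1[k k0 hk]; apply/(range_bound _ sG).
    case: G2 => l l0 hl; exists (k * l) => [|z]; first exact: mulr_ge0.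
    by apply: le_trans (hk z) _; rewrite -mulrA ler_wpM2l.
  move=> /(range_bound _ sG)[k k0 hk]; apply/iff1.
  case: U2 => l l0 hl; exists (k * l) => [|z]; first exact: mulr_ge0.
  by apply: le_trans (hk z) _; rewrite -mulrA ler_wpM2l.
apply/seteqP; split=> [_ [x Gx <-]|x Gx]; first exact/iff2.
by exists (Ui x); [apply/iff2; rewrite UK|exact: UK].
Qed.

End Domination.

(** * The representation of the form *)

Section Representation.
Context {R : realType} {V : hilbertType R}.
Implicit Types (x y z : V) (A H : operator V) (K W : {linear V -> V}).

Lemma op_boundedP A : op_bounded A <->
  exists2 c : R, 0 <= c & forall x y, A (x, y) -> nrm y <= c * nrm x.
Proof.
split=> [[c hc]|[c c0 hc]]; last first.
  exists c%:C%C => x y /hc h; rewrite !normE.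
  by rewrite -(rmorphM (real_complex R)) lecR.
exists `|complex.Re c| => // x y /hc; rewrite !normE lecE => /andP[_].
case: c {hc} => a b /=; rewrite mulr0 subr0 => h.
apply: le_trans h _; apply: ler_wpM2r; [exact: nrm_ge0|exact: ler_norm].
Qed.

Lemma nrm_scale_i x : nrm ('i%C *: x) = nrm x.
Proof. by rewrite nrm_scale normc_def/= expr0n expr1n add0r sqrtr1 mul1r. Qed.

(** Real and imaginary parts are estimated separately, whence the crude factor 2. *)
Lemma inner_bound x y : `|'[x, y]| <= (2 * nrm x * nrm y)%:C%C.
Proof.
rewrite normc_def lecR -(@ler_pXn2r _ 2) ?nnegrE ?sqrtr_ge0 ?mulr_ge0 ?nrm_ge0//.
rewrite sqr_sqrtr ?addr_ge0 ?sqr_ge0// Im_inner -/(rdot x y) sqrrN.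
have h1 := si_cauchy_schwarz rdot_semi_inner x y.
have h2 := si_cauchy_schwarz rdot_semi_inner ('i%C *: x) y.
rewrite !rdot_nrm ?nrm_scale_i in h1 h2.
have : 0 <= nrm x ^+ 2 * nrm y ^+ 2 by rewrite mulr_ge0 ?sqr_ge0.
rewrite !exprMn; lra.
Qed.

Lemma resolvent_set0_inv A : resolvent_set A 0 -> bounded_everywhere (op_inv A).
Proof.
rewrite /resolvent_set/=; congr bounded_everywhere; congr op_inv.
apply/seteqP; split=> [[x y] [a [b [/= h gb ->]]]|[x y] h].
  by rewrite (gb : b = _) /= oppr0 scale0r addr0.
by exists y, 0; split; rewrite /graph/= ?oppr0 ?scale0r ?addr0.
Qed.

Lemma linear_op_inv A : linear_operator A -> (forall x, A (x, 0) -> x = 0) ->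
  linear_operator (op_inv A).
Proof. by move=> [A0 Al _] iA; split=> // a x x' y y' h h'; exact: Al. Qed.

Lemma total_inverse A : linear_operator A -> (forall x, A (x, 0) -> x = 0) ->
  (forall y, exists x, A (x, y)) ->
  exists p : {linear V -> V}, (forall y, A (p y, y)) /\
    forall x y, A (x, y) -> x = p y.
Proof.
move=> lA iA oA; have [|p hp] := linear_of_graph (linear_op_inv lA iA).
  by apply/seteqP; split=> // y _; have [x] := oA y; exists x.
exists p; split=> [y|x y h]; first by have [_ /(_ erefl)] := hp y (p y).
exact/hp.
Qed.

Lemma self_adjoint_inverse A K : self_adjoint A -> (forall y, A (K y, y)) ->
  symmetric_map K.
Proof. by move=> sA hK x y; have := self_adjoint_sym sA (hK x) (hK y). Qed.

Lemma graphE (f : V -> V) x y : graph f (x, y) = (y = f x).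
Proof. by []. Qed.

Lemma linear_graph W : linear_operator (graph W).
Proof.
split=> [|a x x' y y'|y]; rewrite !graphE ?linear0//.
by move=> -> ->; rewrite linearP.
Qed.

Lemma adjoint_graph W W' : (forall x y, rdot (W x) y = rdot x (W' y)) ->
  adjoint (graph W) = graph W'.
Proof.
move=> WW'; have lW := linear_graph W.
apply/seteqP; split=> -[x y]; rewrite graphE.
  by move=> /adjointP h; apply: rdot_orth_eq => z; rewrite -WW'; apply/esym/(h lW).
by move=> ->; apply/adjointP => // z w; rewrite graphE => ->.
Qed.

(* HWH^-1 is everywhere defined as soon as W preserves dom H, and then it is
   bounded by Hellinger-Toeplitz. *)
Lemma bounded_conjugate H (G : {linear V -> V}) W W' : linear_operator H ->
  symmetric_map G -> dense (range G) ->
  (forall x, H (G x, x)) -> (forall x y, H (x, y) -> x = G y) ->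
  (forall x y, rdot (W x) y = rdot x (W' y)) ->
  (forall x, range G (W (G x))) ->
  bounded_everywhere [set q | H (W (G q.1), q.2)].
Proof.
move=> lH sG dG HG GH WW' rW.
have iG y : G y = 0 -> y = 0.
  by move=> Gy; have := HG y; rewrite Gy; case: lH => _ _; apply.
have /choice[f hf] : forall x, exists y, W (G x) = G y.
  by move=> x; have [y _ <-] := rW x; exists y.
have [k fk] : exists k : {linear V -> V}, forall x, k x = f x.
  apply: pack_linear => a x y; apply/eqP; rewrite -subr_eq0; apply/eqP/iG.
  by rewrite (linearB G) -hf (linearP G) (linearP W) (linearP G) !hf subrr.
have -> : [set q | H (W (G q.1), q.2)] = graph k.
  apply/seteqP; split=> -[x y]; rewrite graphE; last by move=> -> /=;
    rewrite hf -fk.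
  move=> /= /GH e.
  apply/eqP; rewrite -subr_eq0; apply/eqP/iG.
  by rewrite linearB/= -e fk -hf subrr.
split.
- exact: linear_graph.
- by apply/seteqP; split=> // x _; exists (k x).
apply/op_boundedP; have [|c c0 hc] := formal_adjoint_bounded (K := k) dG.
  move=> _ [z _ <-]; exists (G (W' z)) => x.
  by rewrite -sG fk -hf WW' sG.
by exists c => // x y; rewrite graphE => ->.
Qed.

(* Both N and the graph norm of G^-1 are complete and stronger than the norm
   of V, so they are comparable. *)
Lemma inverse_bounded_by_norm (G : {linear V -> V}) (N : V -> R[i]) (alpha : R[i]) :
  symmetric_map G -> dense (range G) -> norm_on (range G) N -> 0 < alpha ->
  (forall x, range G x -> `|x| <= alpha * N x) -> complete_on (range G) N ->
  exists2 c : R, 0 <= c & forall k, nrm k <= c * complex.Re (N (G k)).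
Proof.
move=> sG dG [N0 _ NZ ND] a0 aN cN; pose Nr x := complex.Re (N x).
have NE x : range G x -> N x = (Nr x)%:C%C.
  by move=> /N0 h; rewrite RRe_real// ger0_real.
have aE : alpha = (complex.Re alpha)%:C%C by rewrite RRe_real// gtr0_real.
have sD : real_subspace (range G).
  split; first by exists 0; rewrite ?linear0.
  by move=> a _ _ [x _ <-] [y _ <-]; exists (a%:C%C *: x + y); rewrite ?linearP.
have sNr : semi_norm_on (range G) Nr.
  split=> [x Dx|x y Dx Dy|a x Dx].
  - by have := N0 x Dx; rewrite lecE => /andP[].
  - have := ND x y Dx Dy; rewrite (NE (x + y)) ?NE// -?rmorphD ?lecR//.
    exact: real_subspaceD.
  - have := NZ a%:C%C x Dx; rewrite NE; last exact: real_subspaceZ.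
    rewrite (NE x Dx) normc_def/= expr0n addr0 sqrtr_sqr -rmorphM.
    by move=> /complexI.
have cNr : complete_for (range G) Nr (range G).
  move=> u Du cu; have [|x Dx hx] := cN u Du.
    move=> e e0; have eE : e = (complex.Re e)%:C%C by rewrite RRe_real// gtr0_real.
    have [|n hn] := cu (complex.Re e); first by move: e0; rewrite ltcE => /andP[].
    exists n => p q hp hq; rewrite eE NE ?ltcR; first exact: hn.
    exact: real_subspaceB.
  exists x => // e e0; have [|n hn] := hx e%:C%C; first by rewrite (ltcR 0 e).
  exists n => p /hn; rewrite NE ?ltcR//; exact: real_subspaceB.
(* At [y = G k], [<y, l> = <k, G l>] is at most [nrm k] times the weight of [l]. The uniform bound
   replaces [nrm k] by a multiple of [N (G k)], and the vectors [G l] are dense. *)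
have [||||c c0 hc] := uniform_boundedness sD sNr cNr (f := fun l y => rdot y l)
  (b := fun l => nrm (G l)).
- by move=> l; exact: nrm_ge0.
- by move=> l; exact: rdot_linear.
- move=> l; exists (complex.Re alpha * nrm l) => x Dx.
  apply: le_trans (nrm_dot _ _) _; rewrite mulrAC; apply: ler_wpM2r;
    first exact: nrm_ge0.
  by have := aN x Dx; rewrite aE (NE x Dx) normE -rmorphM lecR.
- move=> _ [k _ <-]; exists (nrm k) => l; rewrite sG; exact: nrm_dot.
exists c => // k; have Dk : range G (G k) by exists k.
apply: (dense_dual_norm dG) => [|_ [l _ <-]].
  by rewrite mulr_ge0//; have := N0 _ Dk; rewrite lecE => /andP[].
rewrite -sG; apply: le_trans (ler_norm _) _.
by apply: le_trans (hc l _ Dk) _; rewrite /Nr mulrAC.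
Qed.

End Representation.

(** * Hyper-solvability and invariance of the form domain *)

Theorem theorem4p11 (R : realType) (V : hilbertType R)
  (D : set V) (Om : V -> V -> R[i]) (N : V -> R[i])
  (subspaceD : linear_subspace D) (denseD : dense D)
  (sesquiOm : sesquilinear_on D Om)
  (solvableOm : solvable_form D Om N) (hilbertN : hilbert_norm_on D N)
  (T : operator V) (defT : T = associated_operator D Om)
  (Q : {linear V -> V}) (H : operator V)
  (OmQH : radon_nikodym_representation D Om Q H)
  (Up : V -> V -> R[i]) (PUp : perturbations D Om N Up)
  (B : {linear V -> V}) (boundedB : op_bounded (graph B))
  (UpB : forall x y, Up x y = '[B x, y])
  (TB : operator V) (defTB : TB = op_add T (graph B))
  (U : {linear V -> V}) (polarTB : polar_decomposition TB U)
  (X Y K1 K2 : operator V)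
  (defX : X = op_comp (op_inv H) (op_comp (op_abs TB) (op_inv H)))
  (defY : Y = op_comp H (op_comp (op_inv (op_abs TB)) H))
  (defK1 : K1 = op_comp H (op_comp (graph U) (op_inv H)))
  (defK2 : K2 = op_comp H (op_comp (adjoint (graph U)) (op_inv H))) :
  [<-> hyper_solvable D Om;
       [/\ dom X = op_image H (dom T), dom Y = D, op_bounded X & op_bounded Y];
       bounded_everywhere K1 /\ bounded_everywhere K2;
       U @` D = D].
Proof.
(* Below, G = H^-1, Ui = U^-1, P = |T + B|, p = P^-1, h = H p, Q' = Q + G B G,
   M = |T| and J = (1 + M)^-1. *)
case: solvableOm => -[normN [alpha alpha0 alphaN] complN _ _] _.
case: OmQH => bQ [sH _] domH resH OmE.
case: PUp => [_ injO surjO].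
case: polarTB => [[_ isoU] kerU ranU polE].
have lH : linear_operator H by case: sH.
have H0 k : H (0, k) -> k = 0 by case: lH => _ _; exact.
have [lG GT _] := resolvent_set0_inv resH.
have [G hG] := linear_of_graph lG GT.
have HG x : H (G x, x) by have [_ /(_ erefl)] := hG x (G x).
have GH x y : H (x, y) -> x = G y by move=> h; apply/hG.
have sG := self_adjoint_inverse sH HG.
have iG y : G y = 0 -> y = 0 by move=> Gy; apply: H0; rewrite -Gy.
have GI y z : G y = G z -> y = z.
  by move=> e; apply/eqP; rewrite -subr_eq0; apply/eqP/iG;
    rewrite linearB/= e subrr.
have DG : D = range G.
  rewrite -domH; apply/seteqP; split=> [x [y /GH ->]|_ [y _ <-]]; first by exists y.
  by exists y.
have dG : dense (range G) by rewrite -DG.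
have DGx x : D (G x) by rewrite DG; exists x.
have sGC x y : '[G x, y] = '[x, G y].
  apply: inner_rdot_eq; first exact: sG.
  by rewrite -linearZ/=; exact: sG.
have TE x t : T (x, t) <-> D x /\ forall y, D y -> Om x y = '[t, y].
  by rewrite defT.
have TBE x y : TB (x, y) <-> exists t, T (x, t) /\ y = t + B x.
  rewrite defTB; split=> [[a [b [/= h gb ->]]]|[t [h ->]]].
    by exists a; split=> //; congr (_ + _); exact: gb.
  by exists t, (B x).
have inner0 y : '[0, y] = 0 :> R[i].
  by rewrite -(scale0r 0) linearZl_LR mul0r.
have lT : linear_operator T.
  case: sesquiOm => linOm _; case: subspaceD => D0 Dl; split.
  - apply/TE; split=> // y Dy; rewrite inner0.
    have := linOm y Dy 1 0 0 D0 D0; rewrite scale1r addr0 mul1r => /eqP.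
    by rewrite -subr_eq0 opprD addrA subrr sub0r oppr_eq0 => /eqP.
  - move=> a x x' y y' /TE[Dx h] /TE[Dy h']; apply/TE; split=> [|z Dz].
      exact: Dl.
    by rewrite (linOm z Dz) // h// h'// linearDl linearZl_LR.
  - move=> t /TE[_ h]; apply: (dense_orthogonal denseD) => y Dy.
    rewrite rdotC /rdot -(h _ Dy); have := linOm y Dy 1 0 0 D0 D0.
    rewrite scale1r addr0 mul1r => /eqP.
    by rewrite -subr_eq0 opprD addrA subrr sub0r oppr_eq0 => /eqP ->.
have lTB : linear_operator TB.
  split.
  - by apply/TBE; exists 0; rewrite linear0 addr0; split=> //; case: lT.
  - move=> a x x' y y' /TBE[t [h ->]] /TBE[t' [h' ->]]; apply/TBE.
    exists (a *: t + t'); rewrite linearP scalerDr addrACA; split=> //.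
    by case: lT => _ + _; exact.
  - move=> y /TBE[t [h ->]]; rewrite linear0 addr0.
    by case: lT => _ _; exact.
have TB_form x y : TB (x, y) -> forall z, D z -> Om x z + '[B x, z] = '[y, z].
  move=> /TBE[t [/TE[_ h] ->]] z Dz.
  by rewrite h// linearDl.
have TB_inj x : TB (x, 0) -> x = 0.
  move=> h; have /TBE[t [/TE[Dx _] _]] := h.
  by apply: injO => // y Dy; rewrite UpB (TB_form _ _ h).
(* Admissibility of [Up] is applied to the functional [<y, z>] of [z], bounded for [N] because [N]
   dominates the norm of [V]. *)
have TB_onto y : exists x, TB (x, y).
  have [|x Dx hx] := surjO (fun z => '[y, z]).
    split=> [a u v _ _|]; first by rewrite linearDr linearZr_LR.
    exists ((2 * nrm y)%:C%C * alpha) => z Dz.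
    apply: le_trans (inner_bound y z) _; rewrite rmorphM/= -normE -mulrA.
    by rewrite ler_wpM2l ?alphaN// ler0c mulr_ge0// nrm_ge0.
  exists x; apply/TBE; exists (y - B x); split; last by rewrite subrK.
  by apply/TE; split=> // z Dz; rewrite linearBl/= hx// UpB addrK.
have polP x y : TB (x, y) <-> exists2 v, op_abs TB (x, v) & y = U v.
  by rewrite {1}polE.
(* [TB] is injective and onto, so the initial and final spaces of [U] are the whole space: [U] is
   unitary. *)
have U0 x : U x = 0 -> x = 0.
  move=> Ux; apply: TB_inj; have : ker (graph U) x by rewrite /ker/= graphE Ux.
  by rewrite kerU.
have nU x : nrm (U x) = nrm x.
  have := isoU x; rewrite !normE => h; apply: complexI; apply: h => y /U0 ->.
  by rewrite (inner_conj x) inner0 rmorph0.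
have U_onto y : exists x, U x = y.
  have : ran (graph U) y.
    rewrite ranU; apply: subset_closure; have [x h] := TB_onto y; by exists x.
  by move=> [x]; rewrite graphE => ->; exists x.
have rdotU x y : rdot (U x) (U y) = rdot x y.
  have := rdot_nrm (U (x + y)); rewrite nU -rdot_nrm linearD/= !rdotE.
  rewrite (rdotC (U y)) (rdotC y) !rdot_nrm !nU; lra.
have [Ui [UK UKi]] : exists Ui : {linear V -> V}, (forall y, U (Ui y) = y) /\
    forall x, Ui (U x) = x.
  have [||Ui [h1 h2]] := total_inverse (linear_graph U).
  - by move=> x; rewrite graphE => /esym; exact: U0.
  - by move=> y; have [x <-] := U_onto y; exists x; rewrite graphE.
  by exists Ui; split=> [y|x]; [have := h1 y; rewrite graphE|apply/esym/h2].
have UUi x y : rdot (U x) y = rdot x (Ui y) by rewrite -{1}(UK y) rdotU.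
have UiU x y : rdot (Ui x) y = rdot x (U y) by rewrite rdotC -UUi rdotC.
have [sP pP _] : [/\ self_adjoint (op_abs TB), op_positive (op_abs TB)
    & op_comp (op_abs TB) (op_abs TB) = op_comp (adjoint TB) TB].
  apply: op_sqrt_neq0; have [x /polP[v h _]] := TB_onto 0.
  by exists (x, v).
set P := op_abs TB in polP sP pP *.
have lP : linear_operator P by case: sP.
have [||p [Pp pP_eq]] := total_inverse lP.
- by move=> x Px; apply: TB_inj; apply/polP; exists 0 => //; rewrite linear0.
- move=> v; have [x /polP[w h e]] := TB_onto (U v); exists x.
  by rewrite -(UKi v) e UKi.
have sp := self_adjoint_inverse sP Pp.
have p_ge0 x : 0 <= rdot (p x) x by rewrite rdotC;
  exact: op_positive_rdot pP (Pp x).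
have ip x : p x = 0 -> x = 0.
  by move=> px; have := Pp x; rewrite px; case: lP => _ _; exact.
have TBp v : TB (p v, U v) by apply/polP; exists v.
have pTB x y : TB (x, y) -> x = p (Ui y).
  by move=> /polP[v /pP_eq -> ->]; rewrite UKi.
have domT : dom T = range p.
  apply/seteqP; split=> [x [t h]|_ [v _ <-]].
    have h' : TB (x, t + B x) by apply/TBE; exists t.
    by rewrite (pTB _ _ h'); exists (Ui (t + B x)).
  by have /TBE[t [h _]] := TBp v; exists t.
have domP : dom P = range p.
  by apply/seteqP; split=> [x [y /pP_eq ->]|_ [y _ <-]]; [exists y|exists y].
have dp : dense (range p) by rewrite -domP; case: sP.
have Dp v : D (p v) by have /TBE[t [/TE[]]] := TBp v.
have [h ph] : exists h : {linear V -> V}, forall x, p x = G (h x).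
  have /choice[f hf] : forall x, exists y, p x = G y.
    by move=> x; have := Dp x; rewrite DG => -[y _ <-]; exists y.
  have [h fh] : exists h : {linear V -> V}, forall x, h x = f x.
    by apply: pack_linear => a x y; apply: GI; rewrite -hf !linearP/= !hf.
  by exists h => x; rewrite fh.
have Hh x : H (p x, h x) by rewrite ph.
have [Q' Q'E] : exists Q' : {linear V -> V}, forall x, Q' x = Q x + G (B (G x)).
  apply: pack_linear => a x y /=.
  by rewrite !linearP/= scalerDr addrACA.
have Q'_form k l : Om (G k) (G l) + '[B (G k), G l] = '[Q' k, l].
  by rewrite (OmE _ _ _ _ (HG k) (HG l)) Q'E linearDl/= sGC.
(* Tested against [l], both sides are the perturbed form at [p v] and [G l], because [TB] maps [p v]
   to [U v]. *)
have Q'h v : Q' (h v) = G (U v).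
  apply: rdot_orth_eq => l; rewrite !(rdotC l) /rdot; congr (complex.Re _).
  by rewrite -Q'_form -ph (TB_form _ _ (TBp v)) ?sGC.
have [q q0 Q'_le] : exists2 c : R, 0 <= c & forall x, nrm (Q' x) <= c * nrm x.
  have [a a0 Qa] := (op_boundedP _).1 bQ;
    have [b b0 Bb] := (op_boundedP _).1 boundedB.
  have [g g0 Gg] := symmetric_bounded sG.
  exists (a + g * (b * g)) => [|x]; first by rewrite !(addr_ge0, mulr_ge0).
  rewrite Q'E; apply: le_trans (nrmD _ _) _; rewrite mulrDl lerD//.
    by apply: Qa; rewrite graphE.
  apply: le_trans (Gg _) _; rewrite -mulrA ler_wpM2l//.
  apply: (@le_trans _ _ (b * nrm (G x))); first by apply: Bb; rewrite graphE.
  by rewrite -mulrA ler_wpM2l.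
have Q'_inj x : Q' x = 0 -> x = 0.
  move=> Qx; apply: iG; apply: injO => // y; rewrite DG => -[l _ <-].
  by rewrite UpB Q'_form Qx inner0.
have [n n0 GN] : exists2 c : R, 0 <= c & forall k, nrm k <= c * complex.Re (N (G k)).
  by apply: (inverse_bounded_by_norm (alpha := alpha)); rewrite -?DG.
(* Admissibility is applied to the functional [G l |-> <k, l>], whose boundedness for [N] is [GN].
   [Hf] is a total function that agrees with [H] on [D]. *)
have Q'_onto k : exists x, Q' x = k.
  have /choice[Hf hf] : forall y, exists l, D y -> y = G l.
    move=> y; have [|h0] := pselect (D y); last by exists 0 => /h0.
    by rewrite DG => -[l _ <-]; exists l.
  have HfG l : Hf (G l) = l by apply/esym/GI/hf.
  have [|x Dx hx] := surjO (fun y => '[k, Hf y]).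
    split=> [a y z Dy Dz|].
      have -> : Hf (a *: y + z) = a *: Hf y + Hf z.
        by apply: GI; rewrite linearP -!hf//; case: subspaceD => _; apply.
      by rewrite linearDr linearZr_LR.
    exists (2 * nrm k * n)%:C%C => y; rewrite DG => -[l _ <-]; rewrite HfG.
    apply: le_trans (inner_bound k l) _.
    have NE : N (G l) = (complex.Re (N (G l)))%:C%C.
      by rewrite RRe_real// ger0_real//; case: normN => + _ _ _; apply.
    rewrite NE -(rmorphM (real_complex R)) lecR -[leRHS]mulrA ler_wpM2l//.
    by rewrite mulr_ge0// nrm_ge0.
  move: Dx; rewrite DG => -[m _ mx]; exists m.
  apply: rdot_orth_eq => l; rewrite !(rdotC l) /rdot; congr (complex.Re _).
  by rewrite -Q'_form -UpB mx -hx ?HfG.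
have [q' q'0 Q'_ge] := bounded_inverse Q'_le Q'_inj Q'_onto.
have nG x : 0 <= nrm (G x) by exact: nrm_ge0.
have h_GU : dominated (fun x => nrm (h x)) (fun x => nrm (G (U x))).
  by exists q' => // x; rewrite -Q'h.
have GU_h : dominated (fun x => nrm (G (U x))) (fun x => nrm (h x)).
  by exists q => // x; rewrite -Q'h.
have denseT : dense (dom T) by rewrite domT.
(* [TB] is the inverse of the bounded operator [p Ui], so [x = p (Ui (y + B x))] passes to the
   limit; cancelling [B x] returns to [T]. *)
have closedT : closed_operator T.
  move=> u v x y Tuv ux vy.
  have [b _ Bb] := (op_boundedP _).1 boundedB.
  have {}Bb z : nrm (B z) <= b * nrm z by apply: Bb; rewrite graphE.
  have [k k0 pk] := symmetric_bounded sp.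
  have eu n1 : u n1 = p (Ui (v n1 + B (u n1))).
    by apply: pTB; apply/TBE; exists (v n1).
  have pUi_le z : nrm (p (Ui z)) <= k * nrm z.
    by apply: le_trans (pk _) _; rewrite -(nU (Ui z)) UK.
  have pUi_B a c : p (Ui (a - c)) = p (Ui a) - p (Ui c) by rewrite !linearB.
  have ex : x = p (Ui (y + B x)).
    have := tends_map pUi_B pUi_le (tendsD vy (tends_map (linearB B) Bb ux)).
    move=> lim_u; apply: (tends_unique ux); move: lim_u.
    by congr tends_for; apply/funext => n1 /=; rewrite -eu.
  have := TBp (Ui (y + B x)); rewrite -ex UK => /TBE[t [Txt]].
  by move=> /addIr ->.
have [sM pM domM] := op_abs_spec lT denseT closedT.
set M := op_abs T in sM pM domM.
have [J [[sJ J_ge0 _] MJ JM]] := self_adjoint_resolvent sM pM.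
have lM : linear_operator M by case: sM.
have iJ x : J x = 0 -> x = 0.
  by move=> Jx; have := MJ x; rewrite Jx subr0; case: lM => _ _; exact.
have rJ : range J = range p.
  rewrite -domT -domM; apply/seteqP; split=> [_ [x _ <-]|x [y Mxy]].
    by exists (x - J x).
  by exists (x + y) => //; exact: JM.
have [sS _ SS] := op_sqrt_spec sM pM.
have J_p : dominated (fun x => rdot x (J x)) (fun x => rdot (p x) x).
  have [|c c0 hc] := dominated_of_range sJ sp p_ge0 ip dp; first by rewrite rJ.
  by exists c => // x; rewrite rdotC.
have p_J : dominated (fun x => rdot (p x) x) (fun x => rdot x (J x)).
  have [||c c0 hc] := dominated_of_range sp sJ J_ge0 iJ; rewrite ?rJ//.
  by exists c => // x; rewrite (rdotC x).
have hyperE : hyper_solvable D Om <->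
    dominated (fun x => nrm (h x)) (fun x => nrm (G x)) /\
    dominated (fun x => nrm (G x)) (fun x => nrm (h x)).
  rewrite (dominated_factor sG dG sp p_ge0 ph) /hyper_solvable -defT -/M {1}DG.
  rewrite (dom_root_eq_range sS SS sG MJ JM).
  by split=> -[h1 h2]; split; apply: dominated_trans; eassumption.
have imageE : U @` D = D <->
    dominated (fun x => nrm (h x)) (fun x => nrm (G x)) /\
    dominated (fun x => nrm (G x)) (fun x => nrm (h x)).
  rewrite DG (image_range_eq_iff sG UUi UK UKi).
  by split=> -[h1 h2]; split; apply: dominated_trans; eassumption.
have XE x y : X (x, y) <-> exists2 b, x = h b & y = G b.
  rewrite defX; split=> [[b [a /= Hax Pab] Hyb]|[b -> ->]].
    exists b; last exact: GH.
    by apply: GI; rewrite -ph -(GH _ _ Hax); exact: pP_eq.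
  exists b => /=; last exact: HG.
  exists (p b) => /=; [exact: Hh|exact: Pp].
have YE x y : Y (x, y) <-> exists2 v, x = G v & y = h v.
  rewrite defY; split=> [[b [v /= Hxv Pbv] Hby]|[v -> ->]].
    exists v; first exact: GH.
    have /= bE := pP_eq _ _ Pbv.
    by apply: operator_functional lH Hby _; rewrite bE; exact: Hh.
  exists (p v) => /=; last exact: Hh.
  exists v => /=; [exact: HG|exact: Pp].
have XYE : [/\ dom X = op_image H (dom T), dom Y = D, op_bounded X & op_bounded Y] <->
    dominated (fun x => nrm (h x)) (fun x => nrm (G x)) /\
    dominated (fun x => nrm (G x)) (fun x => nrm (h x)).
  split=> [[_ _ /op_boundedP[a a0 Xa] /op_boundedP[b b0 Yb]]|[[b b0 hG'] [a a0 Gh]]].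
    split; [exists b => // x; apply: Yb; apply/YE|exists a => // x; apply: Xa; apply/XE].
      by exists x.
    by exists x.
  split.
  - apply/seteqP; split=> [x [y /XE[b' -> _]]|x [y Ty /GH ey]].
      exists (p b'); last exact: Hh.
      by rewrite domT; exists b'.
    move: Ty; rewrite domT => -[v _ pv]; exists (G v); apply/XE; exists v => //.
    by apply: GI; rewrite -ey -pv.
  - rewrite DG; apply/seteqP; split=> [x [y /YE[v -> _]]|_ [v _ <-]];
      first by exists v.
    by exists (h v); apply/YE; exists v.
  - by apply/op_boundedP; exists a => // _ _ /XE[v -> ->].
  - by apply/op_boundedP; exists b => // _ _ /YE[v -> ->].
have K_E (W : {linear V -> V}) :
    op_comp H (op_comp (graph W) (op_inv H)) = [set r | H (W (G r.1), r.2)].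
  apply/seteqP; split=> [[x y] [b [a /= /GH /= -> e] Hby]|[x y] /= Hxy].
    by move: e Hby; rewrite graphE => ->.
  exists (W (G x)) => //=; exists (G x) => /=; [exact: HG|by rewrite graphE].
have K1E := K_E U; have K2E := K_E Ui.
rewrite -(adjoint_graph UUi) -defK2 in K2E; rewrite -defK1 in K1E.
(* [K1] is everywhere defined when [U] maps [D] into itself, [K2] when [U^-1] does;
   [bounded_conjugate] supplies the boundedness. *)
have KE : bounded_everywhere K1 /\ bounded_everywhere K2 <-> U @` D = D.
  rewrite K1E K2E; split=> [[[_ d1 _] [_ d2 _]]|e].
    have U_D W : dom [set r | H (W (G r.1), r.2)] = setT -> forall x, D x -> D (W x).
      move=> dW x; rewrite DG => -[y _ <-].
      have [z /= /GH ->] : dom [set r | H (W (G r.1), r.2)] y by rewrite dW.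
      by exists z.
    apply/seteqP; split=> [_ [x Dx <-]|x Dx]; first exact: U_D d1 _ Dx.
    by exists (Ui x); [exact: U_D d2 _ Dx|exact: UK].
  split; apply: (bounded_conjugate lH sG dG HG GH) => [|x]; try eassumption.
    by rewrite -DG -e; exists (G x).
  by have := DGx x; rewrite -{1}e => -[y Dy <-]; rewrite UKi -DG.
tfae.
- by move=> /hyperE/XYE.
- by move=> /XYE/imageE/KE.
- by move=> /KE.
- by move=> /imageE/hyperE.
Qed.
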